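(* Let $n>2$ and let $h \in \mathbb{R}[x_1,\ldots,x_n]$ be a homogeneous polynomial that is irreducible (over $\mathbb{R}$) and hyperbolic, i.e. hyperbolic with respect to some point of $\mathbb{R}^n$. Then the set $\Lambda_h\subseteq\mathbb{R}^n$ of all points with respect to which $h$ is hyperbolic has exactly two connected components.
   Context: A homogeneous polynomial $h \in \mathbb{R}[x_1,\ldots,x_n]$ is hyperbolic with respect to $e \in \mathbb{R}^{n}$ if $h(e)\neq 0$ and, for every $v \in \mathbb{R}^{n}$, the univariate polynomial $h(te+v)\in\mathbb{R}[t]$ has only real roots. The set $\Lambda_h = \{e \in \mathbb{R}^n : h \text{ is hyperbolic with respect to } e\}$ carries the subspace topology from the Euclidean topology on $\mathbb{R}^n$. The polynomial $h$ is called hyperbolic if $\Lambda_h\neq\emptyset$. *)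

(* Defs.v *)
From mathcomp Require Import all_boot all_order all_algebra.
From mathcomp Require Import all_classical all_reals all_analysis.
From mathcomp Require Import complex.
From mathcomp Require Import -(notations) mpoly.

Set Implicit Arguments.
Unset Strict Implicit.
Unset Printing Implicit Defensive.

Import Order.TTheory GRing.Theory Num.Theory.
Import numFieldNormedType.Exports.

Local Open Scope classical_set_scope.
Local Open Scope ring_scope.

(* The notations of [mpoly] are left out: they are incompatible with those of
   MathComp-Analysis. *)
Notation "{ 'mpoly' R [ n ] }" := (mpoly n R)
  (at level 0, R at level 2, n at level 2, format "{ 'mpoly'  R [ n ] }") :
  type_scope.

Definition irreducible_elt (A : idomainType) (a : A) : Prop :=
  [/\ a != 0, a \isn't a GRing.unit &
      forall b c : A, a = b * c -> b \is a GRing.unit \/ c \is a GRing.unit].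

Section Hyperbolic.
Variables (R : realType) (n : nat).
Implicit Types (h : {mpoly R[n]}) (e v : 'rV[R]_n).

Definition homogeneous h : bool := h \is ishomog mdeg.

Definition mpoly_at h e : R := meval (e ord0) h.

(* h(t e + v), as a polynomial in t. *)
Definition line_poly h e v : {poly R} :=
  mmap polyC (fun i => e ord0 i *: 'X + (v ord0 i)%:P) h.

Definition only_real_roots (p : {poly R}) : Prop :=
  forall z : R[i],
    root (map_poly (real_complex R) p) z -> complex.Im z = 0.

Definition hyperbolic_wrt h e : Prop :=
  mpoly_at h e != 0 /\ forall v, only_real_roots (line_poly h e v).

Definition hyperbolicity_set h : set 'rV[R]_n := [set e | hyperbolic_wrt h e].

Definition hyperbolic h : Prop := hyperbolicity_set h !=set0.

End Hyperbolic.

(* [connected] is invariant under passing to the subspace topology of [A], so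
   these are the connected components of [A] as a topological space. *)
Definition connected_components (T : topologicalType) (A : set T) :
    set (set T) :=
  [set connected_component A x | x in A].

(* Main.v *)
Require Import Defs.
From HB Require Import structures.
From mathcomp Require Import all_boot all_order all_algebra.
From mathcomp Require Import all_classical all_reals all_analysis.
From mathcomp Require Import complex.
From mathcomp Require Import -(notations) mpoly.
From mathcomp Require Import ring lra zify.

Set Implicit Arguments.
Unset Strict Implicit.
Unset Printing Implicit Defensive.

Import Order.TTheory GRing.Theory Num.Theory.
Import numFieldNormedType.Exports.

Local Open Scope classical_set_scope.
Local Open Scope ring_scope.

(** Let [h] be hyperbolic with respect to [e] and [x]. For real [v] and [s] in
    the upper half-plane, the polynomial h(te + sx + v) in [t] has no real
    root, so it is, up to a constant, the product of its upper part [f_s] (the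
    roots with positive imaginary part) and its lower part. The coefficients of
    [f_s] are holomorphic in [s], their imaginary parts vanish at the real axis,
    and near infinity Hensel's lemma expands them in powers of 1/s with
    coefficients that are polynomials in [v], provided that h(te + x) has both
    positive and negative roots. The maximum principle then shows that they
    equal the polynomial parts of these expansions. Hence h(te + sx + v)
    factors polynomially in (t, s, v), and t = s = 0 gives a factorization of
    [h]. So if [h] is irreducible, all roots of h(te + x) have the same sign;
    by Garding's theorem the segment from [e] or from [-e] to [x] then stays in
    the hyperbolicity set, and the sum of the roots separates [e] from [-e].

    Analyticity is used only in the form of local polynomial approximation to
    second order, which already yields the maximum principle by averaging over
    s + z, s + iz, s - z, s - iz. *)


(** * The complex modulus as an element of the real field *)

Section Modulus.
Variable R : rcfType.
Local Notation C := R[i].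
Implicit Types (x y z : C) (a b : R).

(** The upper part is given only as a product over a set of roots, with no formula in [s] or [v], so
    all its regularity has to come from stability of factorizations. One Hensel lemma is used twice:
    over the complex numbers around a point [s], with an error of third order, and over the ring of
    polynomials in [v], with 1/s as parameter. The second use is possible because at 1/s = 0 the two
    factors collect the positive and the negative roots of h(te + x). These are real constants, so
    the Bezout relation has constant coefficients and no polynomial in [v] is ever inverted.

    The half-planes and the signs are linked by Im t = Re s Im(t/s) + Im s Re(t/s). Imaginary parts
    of roots are Lipschitz in the parameter, so for large |s| the first term is small compared with
    Im s, even close to the real axis. The upper roots are then those for which t/s is near a
    positive root.

    The polynomial part subtracted from a coefficient is real for real [v]; the difference therefore
    keeps a vanishing imaginary part at the real axis and also tends to 0 at infinity. The final
    factors are proper because both vanish at the origin. *)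

Definition cabs z : R := complex.Re `|z|.

Lemma cabsE z : `|z| = (cabs z)%:C%C.
Proof. by rewrite /cabs RRe_real // normr_real. Qed.

Lemma cabs_ge0 z : 0 <= cabs z.
Proof. by rewrite -lecR -cabsE normr_ge0. Qed.

Lemma cabs0 : cabs 0 = 0.
Proof. by rewrite /cabs normr0. Qed.

Lemma cabs1 : cabs 1 = 1.
Proof. by rewrite /cabs normr1. Qed.

Lemma cabsD x y : cabs (x + y) <= cabs x + cabs y.
Proof. by rewrite -lecR rmorphD /= -!cabsE ler_normD. Qed.

Lemma cabsM x y : cabs (x * y) = cabs x * cabs y.
Proof. by apply: complexI; rewrite rmorphM /= -!cabsE normrM. Qed.

Lemma cabsN x : cabs (- x) = cabs x.
Proof. by rewrite /cabs normrN. Qed.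

Lemma cabsV x : cabs x^-1 = (cabs x)^-1.
Proof. by apply: complexI; rewrite fmorphV /= -!cabsE normfV. Qed.

Lemma cabsX x n : cabs (x ^+ n) = cabs x ^+ n.
Proof. by apply: complexI; rewrite rmorphXn /= -!cabsE normrX. Qed.

Lemma cabs_eq0 x : (cabs x == 0) = (x == 0).
Proof. by rewrite -(inj_eq (@complexI R)) -cabsE normr_eq0. Qed.

Lemma cabs_gt0 x : (0 < cabs x) = (x != 0).
Proof. by rewrite lt_neqAle cabs_ge0 andbT eq_sym cabs_eq0. Qed.

Lemma cabs_real a : cabs a%:C%C = `|a|.
Proof. by apply: complexI; rewrite -cabsE normc_def /= expr0n /= addr0 sqrtr_sqr. Qed.

Lemma cabs_sqr z : cabs z ^+ 2 = complex.Re z ^+ 2 + complex.Im z ^+ 2.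
Proof. by apply: complexI; rewrite rmorphXn /= -cabsE -add_Re2_Im2. Qed.

Lemma cabs_i : cabs 'i%C = 1.
Proof.
by apply: complexI; rewrite -cabsE normc_def /= expr0n /= add0r expr1n sqrtr1.
Qed.

Lemma ler_Re_cabs z : `|complex.Re z| <= cabs z.
Proof. by rewrite -lecR -cabsE normc_ge_Re. Qed.

Lemma ler_Im_cabs z : `|complex.Im z| <= cabs z.
Proof.
rewrite -(ler_pXn2r (n := 2)) ?nnegrE ?cabs_ge0 //.
by rewrite cabs_sqr real_normK ?num_real // lerDr sqr_ge0.
Qed.

Lemma cabs_sum (I : Type) (s : seq I) (P : pred I) (F : I -> C) :
  cabs (\sum_(i <- s | P i) F i) <= \sum_(i <- s | P i) cabs (F i).
Proof.
elim/big_rec2: _ => [|i u v _ le_vu]; first by rewrite cabs0.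
by apply: le_trans (cabsD _ _) _; rewrite lerD2l.
Qed.

Lemma cReD x y : complex.Re (x + y) = complex.Re x + complex.Re y.
Proof. by case: x y => [? ?] [? ?]. Qed.

Lemma cImD x y : complex.Im (x + y) = complex.Im x + complex.Im y.
Proof. by case: x y => [? ?] [? ?]. Qed.

Lemma cReN x : complex.Re (- x) = - complex.Re x.
Proof. by case: x. Qed.

Lemma cImN x : complex.Im (- x) = - complex.Im x.
Proof. by case: x. Qed.

Lemma cReM x y : complex.Re (x * y) =
  complex.Re x * complex.Re y - complex.Im x * complex.Im y.
Proof. by case: x y => [? ?] [? ?]. Qed.

Lemma cImM x y : complex.Im (x * y) =
  complex.Re x * complex.Im y + complex.Im x * complex.Re y.
Proof. by case: x y => [? ?] [? ?]. Qed.

Lemma complex_eqP x y :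
  complex.Re x = complex.Re y -> complex.Im x = complex.Im y -> x = y.
Proof. by case: x y => [? ?] [? ?] /= -> ->. Qed.

Lemma cabs_le_ReIm z : cabs z <= `|complex.Re z| + `|complex.Im z|.
Proof.
rewrite -(ler_pXn2r (n := 2)) ?nnegrE ?cabs_ge0 ?addr_ge0 // cabs_sqr.
rewrite sqrrD !real_normK ?num_real // -addrA [_ *+ 2 + _]addrC addrA lerDl.
by rewrite mulrn_wge0 // mulr_ge0.
Qed.

End Modulus.

(** * The l1 norm of the coefficients of a complex polynomial *)

Section PolyNorm.
Variable R : rcfType.
Local Notation C := R[i].
Implicit Types (p q : {poly C}) (x z : C).

Definition pnorm p : R := \sum_(i < size p) cabs p`_i.

Lemma pnormE n p : (size p <= n)%N -> pnorm p = \sum_(i < n) cabs p`_i.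
Proof.
move=> le_pn; rewrite /pnorm (big_ord_widen n (fun i => cabs p`_i)) //.
rewrite big_mkcond /=; apply: eq_bigr => i _; case: ltnP => // le_pi.
by rewrite nth_default ?cabs0.
Qed.

Lemma pnorm_ge0 p : 0 <= pnorm p.
Proof. by apply: sumr_ge0 => i _; apply: cabs_ge0. Qed.

Lemma cabs_coef p i : cabs p`_i <= pnorm p.
Proof.
have [lt_ip|le_pi] := ltnP i (size p); last first.
  by rewrite nth_default // cabs0 pnorm_ge0.
rewrite /pnorm (bigD1 (Ordinal lt_ip)) //= lerDl.
by apply: sumr_ge0 => j _; apply: cabs_ge0.
Qed.

Lemma pnormD p q : pnorm (p + q) <= pnorm p + pnorm q.
Proof.
pose n := maxn (size p) (size q).
rewrite (@pnormE n (p + q)) ?size_polyD // (@pnormE n p) ?leq_maxl //.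
rewrite (@pnormE n q) ?leq_maxr // -big_split /=; apply: ler_sum => i _.
by rewrite coefD cabsD.
Qed.

Lemma pnormZ x p : pnorm (x *: p) = cabs x * pnorm p.
Proof.
rewrite (@pnormE (size p)) ?size_scale_leq // mulr_sumr.
by apply: eq_bigr => i _; rewrite coefZ cabsM.
Qed.

Lemma pnormN p : pnorm (- p) = pnorm p.
Proof. by rewrite -scaleN1r pnormZ cabsN cabs1 mul1r. Qed.

Lemma pnorm0 : pnorm 0 = 0.
Proof. by rewrite /pnorm size_poly0 big_ord0. Qed.

Lemma pnormB p q : pnorm (p - q) <= pnorm p + pnorm q.
Proof. by rewrite -(pnormN q) pnormD. Qed.

Lemma pnorm_sum (I : Type) (s : seq I) (P : pred I) (F : I -> {poly C}) :
  pnorm (\sum_(i <- s | P i) F i) <= \sum_(i <- s | P i) pnorm (F i).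
Proof.
elim/big_rec2: _ => [|i u v _ le_vu]; first by rewrite pnorm0.
by apply: le_trans (pnormD _ _) _; rewrite lerD2l.
Qed.

Lemma pnorm_mulX p : pnorm (p * 'X) = pnorm p.
Proof.
rewrite (@pnormE (size p).+1) ?(leq_trans (size_polyMleq _ _)) ?size_polyX ?addn2 //.
rewrite big_ord_recl coefMX /= cabs0 add0r.
by apply: eq_bigr => i _; rewrite coefMX.
Qed.

Lemma pnorm_mulXn p n : pnorm (p * 'X^n) = pnorm p.
Proof.
elim: n => [|n IHn]; first by rewrite mulr1.
by rewrite exprSr mulrA pnorm_mulX.
Qed.

Lemma pnorm_monic_ge1 p : p \is monic -> 1 <= pnorm p.
Proof.
by move=> /monicP lc_p; rewrite -(cabs1 R) -lc_p /lead_coef cabs_coef.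
Qed.

Lemma cabs_horner n M p x : (size p <= n)%N -> 1 <= M -> cabs x <= M ->
  cabs p.[x] <= pnorm p * M ^+ n.
Proof.
move=> le_pn M1 le_xM; rewrite (horner_coef_wide x le_pn) (pnormE le_pn).
rewrite mulr_suml; apply: le_trans (cabs_sum _ _ _) _; apply: ler_sum => i _.
rewrite cabsM cabsX; apply: ler_wpM2l; first exact: cabs_ge0.
apply: (le_trans (y := M ^+ i)); first by rewrite lerXn2r ?nnegrE ?cabs_ge0 //; lra.
by rewrite ler_weXn2l // ltnW.
Qed.

(** A form of Cauchy's root bound: if |x| > 1, isolate the leading power in p(x) = 0, bound every
    lower power by |x|^n and divide by |x|^n. *)
Lemma cabs_root_monic p x : p \is monic -> root p x -> cabs x <= pnorm p.
Proof.
move=> p_monic /rootP px0; have p_gt1 := pnorm_monic_ge1 p_monic.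
have [le_x1|lt_1x] := leP (cabs x) 1; first exact: le_trans p_gt1.
have: size p != 0%N by rewrite size_poly_eq0 monic_neq0.
case sp: (size p) => [|n] // _; have pn1 : p`_n = 1.
  by move/monicP: p_monic; rewrite lead_coefE sp.
move: px0; rewrite horner_coef sp big_ord_recr /= pn1 mul1r => /eqP.
rewrite addrC addr_eq0 => /eqP xnE.
have x_gt0 : 0 < cabs x by lra.
case: n sp pn1 xnE => [|n] sp pn1 xnE.
  by move/eqP: xnE; rewrite big_ord0 oppr0 expr0 oner_eq0.
have: cabs x ^+ n.+1 <= pnorm p * cabs x ^+ n.
  rewrite -cabsX xnE cabsN (pnormE (n := n.+2)) ?sp // mulr_suml.
  apply: le_trans (cabs_sum _ _ _) _.
  rewrite [leRHS]big_ord_recr /=; apply: ler_wpDr.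
    by rewrite mulr_ge0 ?cabs_ge0 ?exprn_ge0 ?cabs_ge0.
  apply: ler_sum => i _; rewrite cabsM cabsX ler_wpM2l ?cabs_ge0 //.
  by apply: ler_weXn2l; [exact: ltW | rewrite -ltnS].
by rewrite exprS ler_pM2r // exprn_gt0.
Qed.

(** Synthetic division produces the quotient's coefficients from the top down, each step costing at
    most a factor 1 + M. The constant is therefore uniform in [x] on the disc of radius [M]. *)
Lemma pnorm_divX n M : 1 <= M -> exists2 K, 0 <= K & forall x p q,
  cabs x <= M -> (size q <= n)%N -> ('X - x%:P) * q = p ->
  pnorm q <= K * pnorm p.
Proof.
move=> M1; pose B := 1 + M; have B1 : 1 <= B by rewrite /B; lra.
exists (\sum_(i < n) B ^+ n) => [|x p q le_xM le_qn qE].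
  by apply: sumr_ge0 => i _; rewrite exprn_ge0 //; lra.
have qS i : q`_i = p`_i.+1 + x * q`_i.+1.
  by rewrite -qE mulrBl coefB coefXM coefCM /= subrK.
have bound k i : (n <= i + k)%N -> cabs q`_i <= B ^+ k * pnorm p.
  elim: k i => [|k IHk] i le_nik.
    by rewrite nth_default ?cabs0 ?mulr_ge0 ?pnorm_ge0 // (leq_trans le_qn) // -(addn0 i).
  rewrite qS; apply: le_trans (cabsD _ _) _; rewrite cabsM.
  have Bk1 : 1 <= B ^+ k by rewrite exprn_ege1.
  have q1 := IHk i.+1 _; have {q1}/q1 q1 : (n <= i.+1 + k)%N by rewrite addSnnS.
  have p1 := cabs_coef p i.+1; have p0 := pnorm_ge0 p.
  have : cabs x * cabs q`_i.+1 <= M * (B ^+ k * pnorm p).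
    by apply: ler_pM; rewrite ?cabs_ge0.
  have : pnorm p <= B ^+ k * pnorm p by rewrite ler_peMl.
  rewrite exprS /B; nra.
rewrite (pnormE le_qn) mulr_suml; apply: ler_sum => i _; apply: bound.
by rewrite leq_addl.
Qed.

End PolyNorm.

(** * Quantitative stability of a factorization into two monic factors *)

Section FactorStability.
Variable R : rcfType.
Local Notation C := R[i].
Implicit Types (A B X E Y : {poly C}) (bs fs gs : seq C).

(** Multiplication by each ['X - x] is inverted modulo [A], one root at a time. With y = -E(x)/A(x)
    the polynomial E + yA vanishes at [x], and its quotient by ['X - x] represents the inverse image
    of [E]. The lower bound [c] on |A(x)| controls [y]. *)
Lemma pnorm_modprod m k (M c : R) : 0 < c -> 1 <= M ->
  exists2 K, 1 <= K & forall A X E Y bs,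
    A \is monic -> size A = k.+1 -> pnorm A <= M -> (size bs <= m)%N ->
    (forall x, x \in bs -> cabs x <= M /\ c <= cabs A.[x]) ->
    (size X <= k)%N -> (size E <= k)%N ->
    X * \prod_(x <- bs) ('X - x%:P) = E + A * Y -> pnorm X <= K * pnorm E.
Proof.
move=> c0 M1; elim: m => [|m [K K1 IHm]].
  exists 1 => // A X E Y bs Amon sA _; rewrite leqn0 size_eq0 => /eqP-> _ sX sE.
  (* Here [X - E] is a multiple of the monic [A] of smaller degree, hence zero. *)
  rewrite big_nil mulr1 => XE; suff Y0 : Y = 0 by rewrite XE Y0 mulr0 addr0 mul1r.
  apply/eqP/negPn/negP => Y0; have : (size (X - E)%R <= k)%N.
    by rewrite (leq_trans (size_polyD _ _)) // size_polyN geq_max sX.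
  rewrite XE addrC addKr size_monicM // sA addSn /= -[X in (_ <= X)%N]addn0.
  by rewrite leq_add2l leqn0 size_poly_eq0 (negPf Y0).
have [K1' K1'0 HK1] := pnorm_divX k M1.
pose L := 1 + M ^+ k / c * M.
have Mk0 : 0 <= M ^+ k / c * M.
  by rewrite !mulr_ge0 ?exprn_ge0 ?invr_ge0 //; lra.
exists (Num.max 1 (K * (K1' * L))) => [|A X E Y bs]; first by rewrite le_max lexx.
case: bs => [|x bs] Amon sA nA /= sbs bsP sX sE.
  rewrite big_nil mulr1 => XE; suff -> : X = E.
    by apply: ler_peMl; rewrite ?pnorm_ge0 // le_max lexx.
  suff Y0 : Y = 0 by rewrite XE Y0 mulr0 addr0.
  apply/eqP/negPn/negP => Y0; have : (size (X - E)%R <= k)%N.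
    by rewrite (leq_trans (size_polyD _ _)) // size_polyN geq_max sX.
  rewrite XE addrC addKr size_monicM // sA addSn /= -[X in (_ <= X)%N]addn0.
  by rewrite leq_add2l leqn0 size_poly_eq0 (negPf Y0).
rewrite big_cons mulrCA => XE; set X1 := X * _ in XE.
have [xM cAx] := bsP x (mem_head _ _).
have Ax0 : A.[x] != 0 by rewrite -cabs_gt0 (lt_le_trans c0).
(* Evaluating the congruence at [x] kills its left side and determines [Y.[x]]. *)
have yE : Y.[x] = - E.[x] / A.[x].
  apply: (mulIf Ax0); rewrite divfK // mulrC; apply/eqP.
  by rewrite -addr_eq0 addrC -hornerM -hornerD -XE hornerM hornerXsubC subrr mul0r.
set y := Y.[x] in yE.
have /factor_theorem[Y1 Y1E] : root (Y - y%:P) x.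
  by rewrite rootE !hornerE subrr.
have /factor_theorem[E1 E1E] : root (E + y *: A) x.
  by rewrite rootE !hornerE yE divfK // subrr.
have X1E : X1 = E1 + A * Y1.
  apply: (mulfI (negbT (polyXsubC_eq0 x))).
  rewrite XE mulrDr [_ * E1]mulrC -E1E mulrCA [_ * Y1]mulrC -Y1E mulrBr -mul_polyC.
  by ring.
have sE1 : (size E1 <= k)%N.
  have : (size (E + y *: A)%R <= k.+1)%N.
    rewrite (leq_trans (size_polyD _ _)) // geq_max (leq_trans sE) //=.
    by rewrite (leq_trans (size_scale_leq _ _)) // sA.
  have [->|E10] := eqVneq E1 0; first by rewrite size_poly0.
  by rewrite E1E size_Mmonic ?monicXsubC // size_XsubC addn2.
have nE1 : pnorm E1 <= K1' * (L * pnorm E).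
  apply: le_trans (HK1 x (E + y *: A) E1 xM sE1 _) _; first by rewrite mulrC.
  apply: ler_wpM2l => //; apply: le_trans (pnormD _ _) _.
  rewrite /L mulrDl mul1r lerD2l pnormZ yE cabsM cabsN cabsV.
  have -> : M ^+ k / c * M * pnorm E = pnorm E * M ^+ k * c^-1 * M by ring.
  apply: ler_pM => //; rewrite ?mulr_ge0 ?invr_ge0 ?cabs_ge0 ?pnorm_ge0 //.
  apply: ler_pM; rewrite ?invr_ge0 ?cabs_ge0 //; first exact: cabs_horner.
  by rewrite lef_pV2 // posrE (lt_le_trans c0).
have := IHm A X E1 Y1 bs Amon sA nA sbs _ sX sE1 X1E.
have bsP' z : z \in bs -> cabs z <= M /\ c <= cabs A.[z].
  by move=> zbs; apply: bsP; rewrite inE zbs orbT.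
move=> /(_ bsP')/le_trans; apply.
apply: (le_trans (y := K * (K1' * (L * pnorm E)))).
  by apply: ler_wpM2l => //; lra.
by rewrite !mulrA; apply: ler_wpM2r; rewrite ?pnorm_ge0 // le_max -!mulrA lexx orbT.
Qed.

(** Long division: subtracting a multiple of [A] removes the top coefficient and multiplies the norm
    by at most 1 + M, and at most [n] such steps are made. *)
Lemma pnorm_mod n k (M : R) : 1 <= M ->
  exists2 K, 0 <= K & forall A E,
    A \is monic -> size A = k.+1 -> pnorm A <= M -> (size E <= n)%N ->
    exists E1 Y, [/\ E = E1 + A * Y, (size E1 <= k)%N & pnorm E1 <= K * pnorm E].
Proof.
move=> M1; elim: n => [|n [K K0 IHn]].
  exists 0 => // A E _ _ _; rewrite leqn0 size_poly_eq0 => /eqP->.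
  by exists 0, 0; rewrite mulr0 addr0 size_poly0 pnorm0 mulr0.
exists (Num.max 1 (K * (1 + M))) => [|A E Amon sA nA sE].
  by rewrite le_max ler01.
have [le_Ek|lt_kE] := leqP (size E) k.
  exists E, 0; rewrite mulr0 addr0; split=> //.
  by apply: ler_peMl; rewrite ?pnorm_ge0 // le_max lexx.
have le_kn : (k <= n)%N by rewrite -ltnS (leq_trans lt_kE).
pose T := E`_n *: (A * 'X^(n - k)); pose E' := E - T.
have nT : pnorm T <= M * pnorm E.
  rewrite pnormZ pnorm_mulXn mulrC.
  by apply: ler_pM; rewrite ?pnorm_ge0 ?cabs_ge0 ?cabs_coef.
have sE' : (size E' <= n)%N.
  apply/leq_sizeP => j; rewrite leq_eqVlt => /predU1P[<-|lt_nj]; rewrite coefB coefZ coefMXn.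
    rewrite ltnNge leq_subr /= subKn //.
    move/monicP: Amon; rewrite lead_coefE sA /= => ->.
    by rewrite mulr1 subrr.
  rewrite [E`_j](leq_sizeP _ _ sE) //; case: ifP => [_|/negbT]; first by rewrite mulr0 subr0.
  rewrite -leqNgt => le_nkj; have -> : A`_(j - (n - k)) = 0.
    by rewrite nth_default // sA ltn_subRL subnK.
  by rewrite mulr0 subr0.
have [E1 [Y [E'E sE1 nE1]]] := IHn A E' Amon sA nA sE'.
exists E1, (Y + E`_n *: 'X^(n - k)); split=> //.
  by rewrite mulrDr addrA -E'E -scalerAr /E' subrK.
apply: le_trans nE1 _.
apply: (le_trans (y := K * ((1 + M) * pnorm E))).
  apply: ler_wpM2l => //; apply: le_trans (pnormB _ _) _.
  by rewrite mulrDl mul1r lerD2l.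
by rewrite mulrA; apply: ler_wpM2r; rewrite ?pnorm_ge0 // le_max lexx orbT.
Qed.

(* [A] and [B] approximate the two factors of a product [F * G]; the lower bounds
   on [A] at the roots of [G] and on [B] at the roots of [F] bound the inverse of the
   linear map (X, Y) |-> X * G + A * Y, without any a priori closeness. *)
Lemma factor_stability ka kb (M c : R) : 0 < c -> 1 <= M ->
  exists K eta, [/\ 0 <= K, 0 < eta & forall A B fs gs,
    A \is monic -> B \is monic -> size A = ka.+1 -> size B = kb.+1 ->
    pnorm A <= M -> pnorm B <= M -> (size fs + size gs = ka + kb)%N ->
    (forall x, x \in fs -> cabs x <= M /\ c <= cabs B.[x]) ->
    (forall x, x \in gs -> cabs x <= M /\ c <= cabs A.[x]) ->
    let F := \prod_(x <- fs) ('X - x%:P) in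
    let G := \prod_(x <- gs) ('X - x%:P) in
    pnorm (F * G - A * B) <= eta ->
    size fs = ka /\ pnorm (F - A) <= K * pnorm (F * G - A * B)].
Proof.
move=> c0 M1.
have [Ka Ka1 HKa] := pnorm_modprod (ka + kb) ka c0 M1.
have [Kb Kb1 HKb] := pnorm_modprod (ka + kb) kb c0 M1.
have [La La0 HLa] := pnorm_mod (ka + kb).+1 ka M1.
have [Lb Lb0 HLb] := pnorm_mod (ka + kb).+1 kb M1.
have Kpos : 0 <= Ka * La /\ 0 <= Kb * Lb by split; apply: mulr_ge0; lra.
(* The choice makes both [Ka * La * eta] and [Kb * Lb * eta] smaller than 1, which rules out the two
   wrong degree distributions below. *)
pose eta := (2 + Ka * La + Kb * Lb)^-1.
have eta0 : 0 < eta by rewrite invr_gt0; lra.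
exists (Ka * La), eta; split=> //; first by case: Kpos.
move=> A B fs gs Amon Bmon sA sB nA nB sfg fsP gsP F G.
set E := F * G - A * B => nE.
have sF : size F = (size fs).+1 by rewrite size_prod_XsubC.
have sG : size G = (size gs).+1 by rewrite size_prod_XsubC.
have Fmon : F \is monic by apply: monic_prod_XsubC.
have Gmon : G \is monic by apply: monic_prod_XsubC.
have sE : (size E <= (ka + kb).+1)%N.
  rewrite (leq_trans (size_polyD _ _)) // size_polyN.
  rewrite !size_monicM ?monic_neq0 // sF sG sA sB !addnS !addSn /= sfg.
  by rewrite maxnn.
have small K L : 0 <= K * L -> K * L <= Ka * La + Kb * Lb ->
    K * (L * pnorm E) < 1.
  move=> KL0 KL; rewrite mulrA.
  apply: le_lt_trans (ler_wpM2l KL0 nE) _.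
  by rewrite /eta -[ltLHS]/(_ / _) ltr_pdivrMr; lra.
have [E1 [Y1 [E1E sE1 nE1]]] := HLa A E Amon sA nA sE.
have [E2 [Y2 [E2E sE2 nE2]]] := HLb B E Bmon sB nB sE.
(* If F has degree below [ka], it is itself a small-degree solution of F * G = E modulo [A], so its
   norm is below 1, impossible for a monic polynomial. If its degree is above [ka], the same
   argument applies to G modulo [B]. *)
case: (ltngtP (size fs) ka) => [lt_fa|lt_af|eq_fa].
- exfalso; have : pnorm F <= Ka * pnorm E1.
    apply: (HKa A F E1 (Y1 + B) gs) => //.
    + by rewrite -sfg leq_addl.
    + by rewrite sF.
    + by rewrite mulrDr addrA -E1E subrK.
  have := pnorm_monic_ge1 Fmon; have := small Ka La.
  have : Ka * pnorm E1 <= Ka * (La * pnorm E) by apply: ler_wpM2l => //; lra.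
  by lra.
- exfalso; have : pnorm G <= Kb * pnorm E2.
    apply: (HKb B G E2 (Y2 + A) fs) => //.
    + by rewrite -sfg leq_addr.
    + by rewrite sG -(ltn_add2l (size fs)) sfg ltn_add2r.
    + by rewrite mulrDr addrA -E2E [G * _]mulrC [B * A]mulrC subrK.
  have := pnorm_monic_ge1 Gmon; have := small Kb Lb.
  have : Kb * pnorm E2 <= Kb * (Lb * pnorm E) by apply: ler_wpM2l => //; lra.
  by lra.
split=> //.
have sFA : (size (F - A)%R <= ka)%N.
  apply/leq_sizeP => j; rewrite leq_eqVlt => /predU1P[<-|lt_aj]; rewrite coefB.
    have /monicP := Fmon; have /monicP := Amon.
    by rewrite !lead_coefE sA sF eq_fa /= => -> ->; rewrite subrr.
  by rewrite !nth_default ?subrr // ?sA ?sF ?eq_fa.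
(* In equal degree the leading terms cancel, so [F - A] is the small-degree solution, again with
   right side [E] modulo [A]. *)
have : pnorm (F - A) <= Ka * pnorm E1.
  apply: (HKa A (F - A) E1 (Y1 + B - G) gs) => //; first by rewrite -sfg leq_addl.
  have -> : E1 + A * (Y1 + B - G) = E + A * B - A * G by rewrite E1E; ring.
  by rewrite /E -/G; ring.
move/le_trans; apply; rewrite -mulrA; apply: ler_wpM2l => //; lra.
Qed.

End FactorStability.

(** * Hensel lifting along a parameter *)

Section Hensel.
Variable A : comNzRingType.
Implicit Types (p f g u v : {poly A}) (P a b E : {poly {poly A}}).

Lemma poly_constX (B : nzRingType) (p : {poly B}) :
  exists q, p = (p`_0)%:P + 'X * q.
Proof.
exists (\poly_(i < size p) p`_i.+1); apply/polyP => -[|i].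
  by rewrite coefD coefC coefXM addr0.
rewrite coefD coefC coefXM /= add0r coef_poly; case: ltnP => // le_pi.
by rewrite nth_default // leqW.
Qed.

Lemma ltn_predD (x y s t : nat) :
  (0 < s)%N -> (x <= s)%N -> (y < t)%N -> ((x + y).-1 < (s + t).-1)%N.
Proof. lia. Qed.

(** The outer variable is the parameter. At each order the leading error [e] is written as al * g0 +
    be * f0, by the Bezout relation followed by reduction of v * e modulo the monic [f0]; [al] and
    [be] are the next corrections. Only monicity and a given Bezout relation enter, so the
    coefficient ring may itself be a polynomial ring. The degree bounds keep both lifted factors
    monic of constant degree in the inner variable. *)
Lemma hensel_lift f0 g0 u v P N :
  f0 \is monic -> g0 \is monic -> u * f0 + v * g0 = 1 -> P`_0 = f0 * g0 ->
  (forall i, (0 < i)%N -> (size (P`_i)%R < size (f0 * g0)%R)%N) ->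
  exists a b E, [/\ a`_0 = f0, b`_0 = g0,
    forall i, (0 < i)%N -> (size (a`_i)%R < size f0)%N,
    forall i, (0 < i)%N -> (size (b`_i)%R < size g0)%N &
    P = a * b + 'X^(N.+1) * E].
Proof.
move=> f0mon g0mon bezout P0 sP.
have f00 : (0 < size f0)%N by rewrite size_poly_gt0 monic_neq0.
have g00 : (0 < size g0)%N by rewrite size_poly_gt0 monic_neq0.
have sfg : size (f0 * g0) = (size f0 + size g0).-1 by rewrite size_monicM ?monic_neq0.
elim: N => [|N [a [b [E [a0 b0 sa sb PE]]]]].
  have [Q PQ] := poly_constX P.
  exists f0%:P, g0%:P, Q; rewrite !coefC /= -polyCM -P0 expr1 -PQ; split=> //.
    by case=> // i _; rewrite coefC size_poly0.
  by case=> // i _; rewrite coefC size_poly0.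
have sa' i : (size (a`_i)%R <= size f0)%N by case: i => [|i]; rewrite ?a0 // ltnW // sa.
have sb' i : (size (b`_i)%R <= size g0)%N by case: i => [|i]; rewrite ?b0 // ltnW // sb.
pose e := E`_0; have [E' EE'] := poly_constX E.
have se : (size e < size (f0 * g0)%R)%N.
  have -> : e = P`_N.+1 - (a * b)`_N.+1.
    by rewrite PE coefD [X in X - _]addrC addrK coefXnM ltnn subnn.
  rewrite (leq_ltn_trans (size_polyD _ _)) // gtn_max sP //= size_polyN.
  rewrite coefM; apply: (big_ind (fun p => (size p < size (f0 * g0)%R)%N)) => [|p q|i _].
  - by rewrite size_poly0 size_poly_gt0 monic_neq0 ?monicMl.
  - by move=> sp sq; rewrite (leq_ltn_trans (size_polyD _ _)) // gtn_max sp.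
  rewrite (leq_ltn_trans (size_polyMleq _ _)) // sfg.
  case: (posnP i) => [->|i0].
    by rewrite subn0 a0; apply: ltn_predD; rewrite // sb.
  by rewrite addnC [X in (_ < X.-1)%N]addnC; apply: ltn_predD; rewrite ?sa.
pose al := Pdiv.Ring.rmodp (v * e) f0; pose q := Pdiv.Ring.rdivp (v * e) f0.
pose be := u * e + q * g0.
have veE : v * e = q * f0 + al by rewrite /q /al -Pdiv.RingMonic.rdivp_eq.
have eE : al * g0 + be * f0 = e.
  have -> : al = v * e - q * f0 by rewrite veE addrC addKr.
  by rewrite -[RHS]mul1r -bezout /be; ring.
have sal : (size al < size f0)%N by rewrite Pdiv.Ring.ltn_rmodpN0 ?monic_neq0.
(* [be * f0] is [e - al * g0], of degree below that of [f0 * g0]; since [f0] is monic, its degree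
   can be subtracted. *)
have sbe : (size be < size g0)%N.
  have [->|be0] := eqVneq be 0; first by rewrite size_poly0.
  have : (size (be * f0)%R < size (f0 * g0)%R)%N.
    rewrite -(addKr (al * g0) (be * f0)) eE addrC.
    rewrite (leq_ltn_trans (size_polyD _ _)) // gtn_max se /= size_polyN.
    by rewrite (leq_ltn_trans (size_polyMleq _ _)) // sfg addnC [X in (_ < X.-1)%N]addnC ltn_predD.
  rewrite size_Mmonic // sfg addnC; case: (size f0) f00 => // m _.
  by rewrite !addSn /= ltn_add2l.
have [a' aE] := poly_constX a; have [b' bE] := poly_constX b.
rewrite a0 in aE; rewrite b0 in bE.
exists (a + al%:P * 'X^(N.+1)), (b + be%:P * 'X^(N.+1)).
exists (E' - al%:P * b' - be%:P * a' - 'X^N * (al * be)%:P).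
split.
- by rewrite coefD coefMXn /= addr0.
- by rewrite coefD coefMXn /= addr0.
- move=> i i0; rewrite coefD (leq_ltn_trans (size_polyD _ _)) // gtn_max sa //=.
  by rewrite coefMXn; case: ifP => _; rewrite ?size_poly0 // coefC; case: ifP; rewrite ?size_poly0.
- move=> i i0; rewrite coefD (leq_ltn_trans (size_polyD _ _)) // gtn_max sb //=.
  by rewrite coefMXn; case: ifP => _; rewrite ?size_poly0 // coefC; case: ifP; rewrite ?size_poly0.
rewrite PE EE' -/e -eE polyCD !polyCM.
have -> : (a + al%:P * 'X^(N.+1)) * (b + be%:P * 'X^(N.+1)) =
    a * b + 'X^(N.+1) * (al%:P * b + be%:P * a + 'X^(N.+1) * (al%:P * be%:P)) by ring.
set ab := a * b; rewrite [X in al%:P * X]bE [X in be%:P * X]aE !exprS; ring.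
Qed.

End Hensel.

(** * Distance between the true factors and the lifted ones *)

Section HenselStability.
Variable R : rcfType.
Local Notation C := R[i].
Implicit Types (f g p : {poly C}) (P Q a b E : {poly {poly C}}) (x z : C).

Lemma hornerC_sum Q z : Q.[z%:P] = \sum_(i < size Q) z ^+ i *: Q`_i.
Proof.
rewrite horner_coef; apply: eq_bigr => i _.
by rewrite -polyC_exp mulrC mul_polyC.
Qed.

Lemma pnorm_eval Q (B : R) : 0 <= B ->
  exists2 K, 0 <= K & forall z, cabs z <= B -> pnorm Q.[z%:P] <= K.
Proof.
move=> B0; exists (\sum_(i < size Q) B ^+ i * pnorm Q`_i) => [|z zB].
  by apply: sumr_ge0 => i _; rewrite mulr_ge0 ?exprn_ge0 ?pnorm_ge0.
rewrite hornerC_sum; apply: le_trans (pnorm_sum _ _ _) _.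
apply: ler_sum => i _; rewrite pnormZ cabsX ler_wpM2r ?pnorm_ge0 //.
by rewrite lerXn2r ?nnegrE ?cabs_ge0.
Qed.

Lemma size_eval_lt Q z s : (forall i, (size (Q`_i)%R < s)%N) ->
  (size Q.[z%:P] < s)%N.
Proof.
move=> sQ; rewrite hornerC_sum.
apply: (big_ind (fun p => (size p < s)%N)) => [|p q sp sq|i _].
- by rewrite size_poly0 (leq_ltn_trans _ (sQ 0%N)).
- by rewrite (leq_ltn_trans (size_polyD _ _)) // gtn_max sp.
- by rewrite (leq_ltn_trans (size_scale_leq _ _)).
Qed.

Lemma poly_headX P : (forall i, (0 < i)%N -> (size (P`_i)%R < size (P`_0)%R)%N) ->
  P`_0 \is monic -> exists Q,
  [/\ forall z, P.[z%:P] = P`_0 + z *: Q.[z%:P],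
      forall z, (size Q.[z%:P] < size (P`_0)%R)%N,
      forall z, size P.[z%:P] = size (P`_0)%R &
      forall z, P.[z%:P] \is monic].
Proof.
move=> sP P0mon; have [Q PQ] := poly_constX P.
have PE z : P.[z%:P] = P`_0 + z *: Q.[z%:P].
  by rewrite {1}PQ hornerD hornerC hornerM hornerX mul_polyC.
have sQ z : (size Q.[z%:P] < size (P`_0)%R)%N.
  apply: size_eval_lt => i; have := sP i.+1 isT.
  by rewrite {1}PQ coefD coefC coefXM /= add0r.
have szQ z : (size (z *: Q.[z%:P])%R < size (P`_0)%R)%N.
  by rewrite (leq_ltn_trans (size_scale_leq _ _)).
exists Q; split=> // z; first by rewrite PE size_polyDl.
by rewrite monicE PE lead_coefDl // -monicE.
Qed.

(** The roots are assigned to the factors by the regions [S1] and [S2], not by closeness to roots of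
    [f0] and [g0], so no continuity of roots is invoked. The bounds of [f0] on [S2] and of [g0] on
    [S1] survive with c / 2 for the lifted factors at small [z]; this is the input that
    [factor_stability] asks for, with the Hensel error as the defect. The regions will be
    half-planes, both around a finite point and at infinity. *)
Lemma hensel_stability f0 g0 P a b E N (c : R) (S1 S2 : C -> Prop) :
  f0 \is monic -> g0 \is monic -> a`_0 = f0 -> b`_0 = g0 ->
  (forall i, (0 < i)%N -> (size (a`_i)%R < size f0)%N) ->
  (forall i, (0 < i)%N -> (size (b`_i)%R < size g0)%N) ->
  P`_0 = f0 * g0 ->
  (forall i, (0 < i)%N -> (size (P`_i)%R < size (f0 * g0)%R)%N) ->
  P = a * b + 'X^(N.+1) * E -> 0 < c ->
  (forall x, S2 x -> c <= cabs f0.[x]) -> (forall x, S1 x -> c <= cabs g0.[x]) ->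
  exists r K, [/\ 0 < r, 0 <= K & forall z fs gs, cabs z < r ->
    P.[z%:P] = \prod_(x <- fs) ('X - x%:P) * \prod_(x <- gs) ('X - x%:P) ->
    (forall x, x \in fs -> S1 x) -> (forall x, x \in gs -> S2 x) ->
    size fs = (size f0).-1 /\
    pnorm (\prod_(x <- fs) ('X - x%:P) - a.[z%:P]) <= K * cabs z ^+ N.+1].
Proof.
move=> f0mon g0mon a0 b0 sa sb P0 sP PE c0 S2P S1P.
have f00 : (0 < size f0)%N by rewrite size_poly_gt0 monic_neq0.
have g00 : (0 < size g0)%N by rewrite size_poly_gt0 monic_neq0.
have [a' [aE sa' saz amon]] : exists a',
  [/\ forall z, a.[z%:P] = f0 + z *: a'.[z%:P],
      forall z, (size a'.[z%:P] < size f0)%N,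
      forall z, size a.[z%:P] = size f0 & forall z, a.[z%:P] \is monic].
  by have := @poly_headX a; rewrite a0; apply.
have [b' [bE sb' sbz bmon]] : exists b',
  [/\ forall z, b.[z%:P] = g0 + z *: b'.[z%:P],
      forall z, (size b'.[z%:P] < size g0)%N,
      forall z, size b.[z%:P] = size g0 & forall z, b.[z%:P] \is monic].
  by have := @poly_headX b; rewrite b0; apply.
have [_ [_ _ sPz Pmon]] : exists Q,
  [/\ forall z, P.[z%:P] = f0 * g0 + z *: Q.[z%:P],
      forall z, (size Q.[z%:P] < size (f0 * g0)%R)%N,
      forall z, size P.[z%:P] = size (f0 * g0)%R & forall z, P.[z%:P] \is monic].
  by have := @poly_headX P; rewrite P0; apply=> //; rewrite monicMl.
have [KP KP0 nP] := pnorm_eval P ler01.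
have [Ka Ka0 na] := pnorm_eval a ler01; have [Kb Kb0 nb] := pnorm_eval b ler01.
have [Ka' Ka'0 na'] := pnorm_eval a' ler01; have [Kb' Kb'0 nb'] := pnorm_eval b' ler01.
have [KE KE0 nE] := pnorm_eval E ler01.
pose M := 1 + KP + Ka + Kb; have M1 : 1 <= M by rewrite /M; lra.
have c20 : 0 < c / 2 by rewrite divr_gt0.
have [K [eta [K0 eta0 stab]]] :=
  factor_stability (size f0).-1 (size g0).-1 c20 M1.
pose La := 2 / c * (Ka' * M ^+ size f0); pose Lb := 2 / c * (Kb' * M ^+ size g0).
have M0 n : 0 <= M ^+ n by apply: exprn_ge0; lra.
have La0 : 0 <= La by rewrite !mulr_ge0 ?invr_ge0 // ltW.
have Lb0 : 0 <= Lb by rewrite !mulr_ge0 ?invr_ge0 // ltW.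
have Le0 : 0 <= KE / eta by rewrite mulr_ge0 // invr_ge0 ltW.
(* Each summand is one demand on |z| < 1/L: |z| at most 1, a loss of at most c / 2 in either lower
   bound, and a defect of at most [eta]. *)
pose L := 1 + La + Lb + KE / eta.
have L0 : 0 < L by rewrite /L; lra.
exists L^-1, (K * KE); split; rewrite ?invr_gt0 ?mulr_ge0 //.
move=> z fs gs zr Pz fsP gsP.
have zL T : 0 <= T -> T <= L -> cabs z * T <= 1.
  move=> T0 TL; apply: le_trans (_ : cabs z * L <= 1).
    by apply: ler_wpM2l => //; apply: cabs_ge0.
  by rewrite -ler_pdivlMr // div1r ltW.
have z1 : cabs z <= 1 by rewrite -(mulr1 (cabs z)) zL // /L; lra.
have lower f g (h : {poly C}) K' x : (size h < size f)%N -> g = f + z *: h ->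
    c <= cabs f.[x] -> cabs x <= M -> pnorm h <= K' ->
    2 / c * (K' * M ^+ size f) <= L -> c / 2 <= cabs g.[x].
  move=> sh -> cf xM nh hL.
  have h1 : cabs h.[x] <= K' * M ^+ size f.
    apply: le_trans (cabs_horner (ltnW sh) M1 xM) _.
    by apply: ler_wpM2r.
  have h2 : cabs z * cabs h.[x] <= c / 2.
    apply: (le_trans (y := cabs z * (K' * M ^+ size f))).
      by apply: ler_wpM2l => //; apply: cabs_ge0.
    have T0 : 0 <= K' * M ^+ size f by apply: le_trans h1; apply: cabs_ge0.
    have := zL (2 / c * (K' * M ^+ size f)) _ hL.
    move=> /(_ (mulr_ge0 (ltW (divr_gt0 (ltr0Sn _ _) c0)) T0)).
    rewrite -(ler_pM2l c20) mulr1; congr (_ <= _); field.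
    by rewrite gt_eqF.
  have : cabs f.[x] <= cabs (f + z *: h).[x] + cabs z * cabs h.[x].
    have -> : f.[x] = (f + z *: h).[x] - z * h.[x] by rewrite hornerD hornerZ addrK.
    by apply: le_trans (cabsD _ _) _; rewrite cabsN cabsM.
  by lra.
have Pnorm := nP z z1.
have root_le x : (x \in fs) || (x \in gs) -> cabs x <= M.
  move=> xfg; apply: le_trans (_ : KP <= M); last by rewrite /M; lra.
  apply: le_trans Pnorm; apply: cabs_root_monic; first exact: Pmon.
  by rewrite Pz rootM !root_prod_XsubC.
have nEz : pnorm (P.[z%:P] - a.[z%:P] * b.[z%:P]) <= cabs z ^+ N.+1 * KE.
  rewrite PE hornerD hornerM addrC addKr hornerM hornerXn -polyC_exp mul_polyC.
  by rewrite pnormZ cabsX ler_wpM2l ?exprn_ge0 ?cabs_ge0 ?nE.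
have zN : cabs z ^+ N.+1 <= cabs z.
  by rewrite exprS ler_piMr ?cabs_ge0 // exprn_ile1 // cabs_ge0.
rewrite Pz in nEz.
have sfg : (size fs + size gs = (size f0).-1 + (size g0).-1)%N.
  have := sPz z; rewrite Pz !size_monicM ?monic_neq0 ?monic_prod_XsubC //.
  rewrite !size_prod_XsubC; case: (size f0) f00 => // m _.
  by case: (size g0) g00 => // k _; rewrite !addnS !addSn /= => -[].
have [] := stab a.[z%:P] b.[z%:P] fs gs (amon z) (bmon z) _ _ _ _ sfg.
- by rewrite saz prednK.
- by rewrite sbz prednK.
- by apply: le_trans (na z z1) _; rewrite /M; lra.
- by apply: le_trans (nb z z1) _; rewrite /M; lra.
- move=> x xfs; have xM := root_le x; rewrite xfs in xM; split; first exact: xM.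
  apply: (lower g0 _ b'.[z%:P] Kb') => //; [exact: S1P (fsP x xfs) | exact: xM | exact: nb' | ].
  by rewrite -/Lb /L; lra.
- move=> x xgs; have xM := root_le x; rewrite xgs orbT in xM; split; first exact: xM.
  apply: (lower f0 _ a'.[z%:P] Ka') => //; [exact: S2P (gsP x xgs) | exact: xM | exact: na' | ].
  by rewrite -/La /L; lra.
- apply: le_trans nEz _; apply: le_trans (_ : cabs z * KE <= _).
    exact: ler_wpM2r.
  have : cabs z * (KE / eta) <= 1 by apply: zL => //; rewrite /L; lra.
  by rewrite mulrA ler_pdivrMr // mul1r.
move=> sf nf; split=> //; apply: le_trans nf _; rewrite -mulrA ler_wpM2l //.
by rewrite [KE * _]mulrC.
Qed.

End HenselStability.

Lemma bezout_coprime (F : fieldType) (f g : {poly F}) :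
  coprimep f g -> exists u v, u * f + v * g = 1.
Proof.
move=> /Bezout_coprimepP[[u v] /= uv1].
have [c c0 cE] : exists2 c, c != 0 & u * f + v * g = c%:P.
  by apply/size_poly1P; rewrite (eqp_size uv1) size_poly1.
exists (c^-1 *: u), (c^-1 *: v).
by rewrite -!scalerAl -scalerDr cE -mul_polyC -polyCM mulVf.
Qed.

(** * Splitting the roots of a polynomial by the sign of the imaginary part *)

Section RootSplitting.
Variable R : rcfType.
Local Notation C := R[i].
Implicit Types (f g p : {poly C}) (P : {poly {poly C}}) (x z : C) (rs : seq C).

Definition croots p : seq C := sval (closed_field_poly_normal p).

Lemma crootsE p : p = lead_coef p *: \prod_(x <- croots p) ('X - x%:P).
Proof. by rewrite /croots; case: (closed_field_poly_normal p). Qed.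

Lemma mem_croots p x : p != 0 -> (x \in croots p) = root p x.
Proof.
move=> p0; rewrite {2}[p]crootsE rootZ ?lead_coef_eq0 //.
by rewrite root_prod_XsubC.
Qed.

Lemma size_croots p : p != 0 -> size (croots p) = (size p).-1.
Proof.
move=> p0; rewrite {2}[p]crootsE size_scale ?lead_coef_eq0 //.
by rewrite size_prod_XsubC.
Qed.

Definition upper_roots p := [seq x <- croots p | 0 < complex.Im x].
(** The exact complement, so that [upper_partM] holds for every [p]. Real roots would land here;
    where strict negativity matters, their absence is a hypothesis. *)
Definition lower_roots p := [seq x <- croots p | ~~ (0 < complex.Im x)].
Definition upper_part p := \prod_(x <- upper_roots p) ('X - x%:P).
Definition lower_part p := \prod_(x <- lower_roots p) ('X - x%:P).

Lemma upper_partM p : p = lead_coef p *: (upper_part p * lower_part p).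
Proof.
rewrite {1}[p]crootsE; congr (_ *: _).
rewrite (bigID (fun x => 0 < complex.Im x)) /=.
by rewrite /upper_part /lower_part !big_filter.
Qed.

Lemma upper_part_monic p : upper_part p \is monic.
Proof. exact: monic_prod_XsubC. Qed.

Lemma lower_part_monic p : lower_part p \is monic.
Proof. exact: monic_prod_XsubC. Qed.

Lemma size_upper_part p : size (upper_part p) = (size (upper_roots p)).+1.
Proof. exact: size_prod_XsubC. Qed.

Lemma size_lower_part p : size (lower_part p) = (size (lower_roots p)).+1.
Proof. exact: size_prod_XsubC. Qed.

Lemma mem_upper_roots p x : p != 0 ->
  (x \in upper_roots p) = root p x && (0 < complex.Im x).
Proof. by move=> p0; rewrite mem_filter mem_croots // andbC. Qed.

Lemma mem_lower_roots p x : p != 0 ->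
  (x \in lower_roots p) = root p x && ~~ (0 < complex.Im x).
Proof. by move=> p0; rewrite mem_filter mem_croots // andbC. Qed.

Lemma lower_roots_lt0 p x : p != 0 ->
  (forall x, root p x -> complex.Im x != 0) -> x \in lower_roots p ->
  complex.Im x < 0.
Proof.
move=> p0 pr; rewrite mem_lower_roots // => /andP[rx].
by rewrite -leNgt le_eqVlt (negPf (pr x rx)).
Qed.

Lemma seq_lower_bound (phi : C -> R) rs : (forall x, x \in rs -> 0 < phi x) ->
  exists2 r, 0 < r & forall x, x \in rs -> r <= phi x.
Proof.
elim: rs => [|y rs IHrs] h; first by exists 1.
have [x xrs|r r0 hr] := IHrs; first by apply: h; rewrite inE xrs orbT.
exists (Num.min r (phi y)); first by rewrite lt_min r0 h ?mem_head.
move=> x; rewrite inE => /predU1P[->|/hr]; first by rewrite ge_min lexx orbT.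
by rewrite ge_min => ->.
Qed.

Lemma cabs_prod_ge rs x r : 0 <= r -> (forall y, y \in rs -> r <= cabs (x - y)) ->
  r ^+ size rs <= cabs (\prod_(y <- rs) ('X - y%:P)).[x].
Proof.
move=> r0; elim: rs => [|y rs IHrs] h; first by rewrite big_nil hornerC cabs1.
rewrite big_cons hornerM hornerXsubC cabsM exprS.
apply: ler_pM; rewrite ?exprn_ge0 ?h ?mem_head ?IHrs // => z zrs.
by apply: h; rewrite inE zrs orbT.
Qed.

(** A point of one open half-plane keeps a positive distance from the finitely many roots of [P_0]
    in the other, so the two half-planes serve as the regions of [hensel_stability]; the two parts
    are coprime for the same reason. *)
Lemma upper_part_local P : P`_0 \is monic ->
  (forall i, (0 < i)%N -> (size (P`_i)%R < size (P`_0)%R)%N) ->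
  (forall x, root P`_0 x -> complex.Im x != 0) ->
  exists (a : {poly {poly C}}) r K, [/\ 0 < r, 0 <= K & forall z, cabs z < r ->
    (forall x, root P.[z%:P] x -> complex.Im x != 0) ->
    size (upper_part P.[z%:P]) = size (upper_part P`_0) /\
    pnorm (upper_part P.[z%:P] - a.[z%:P]) <= K * cabs z ^+ 3].
Proof.
move=> P0mon sP P0r; set f0 := upper_part P`_0; set g0 := lower_part P`_0.
have P0n0 := monic_neq0 P0mon.
have f0mon : f0 \is monic := upper_part_monic _.
have g0mon : g0 \is monic := lower_part_monic _.
have P0E : P`_0 = f0 * g0.
  by rewrite {1}[P`_0]upper_partM (monicP P0mon) scale1r.
have f0P x : x \in upper_roots P`_0 -> 0 < complex.Im x.
  by rewrite mem_upper_roots // => /andP[].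
have g0P x : x \in lower_roots P`_0 -> complex.Im x < 0.
  exact: lower_roots_lt0.
have [u [v uv1]] : exists u v, u * f0 + v * g0 = 1.
  apply/bezout_coprime/Pdiv.ClosedField.coprimepP => x.
  rewrite root_prod_XsubC => /f0P x0; apply/negP => /rootP/rootP.
  rewrite root_prod_XsubC => /g0P.
  by rewrite ltNge ltW.
have sP' i : (0 < i)%N -> (size (P`_i)%R < size (f0 * g0)%R)%N.
  by rewrite -P0E; apply: sP.
(* Order 2 leaves an error of order |z|^3, the precision that [taylor2] demands. *)
have [a [b [E [a0 b0 sa sb PE]]]] := hensel_lift 2 f0mon g0mon uv1 P0E sP'.
have [r1 r10 hr1] := seq_lower_bound f0P.
have [r2 r20 hr2] : exists2 r, 0 < r &
    forall x, x \in lower_roots P`_0 -> r <= - complex.Im x.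
  by apply: seq_lower_bound => x /g0P; rewrite oppr_gt0.
pose c := Num.min (r1 ^+ size (upper_roots P`_0)) (r2 ^+ size (lower_roots P`_0)).
have c0 : 0 < c by rewrite lt_min !exprn_gt0.
have S2P x : complex.Im x < 0 -> c <= cabs f0.[x].
  move=> x0; rewrite ge_min; apply/orP; left.
  apply: cabs_prod_ge => [|y yf]; first exact: ltW.
  apply: le_trans (ler_Im_cabs _); rewrite cImD cImN.
  have := hr1 y yf => h; rewrite ler_normr; apply/orP; right.
  by rewrite opprD opprK; lra.
have S1P x : 0 < complex.Im x -> c <= cabs g0.[x].
  move=> x0; rewrite ge_min; apply/orP; right.
  apply: cabs_prod_ge => [|y yf]; first exact: ltW.
  apply: le_trans (ler_Im_cabs _); rewrite cImD cImN.
  have := hr2 y yf => h; rewrite ler_normr; apply/orP; left.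
  by lra.
have [r [K [r0 K0 stab]]] :=
  hensel_stability f0mon g0mon a0 b0 sa sb P0E sP' PE c0 S2P S1P.
exists a, r, K; split=> // z zr Pzr.
have [_ [_ _ _ Pmon]] := poly_headX sP P0mon.
have Pz0 := monic_neq0 (Pmon z).
have [] := stab z (upper_roots P.[z%:P]) (lower_roots P.[z%:P]) zr _ _ _.
- by rewrite {1}[P.[z%:P]]upper_partM (monicP (Pmon z)) scale1r.
- by move=> x; rewrite mem_upper_roots // => /andP[].
- by move=> x; apply: lower_roots_lt0.
move=> sf nf; split=> //.
by rewrite size_upper_part sf prednK // size_poly_gt0 monic_neq0.
Qed.

End RootSplitting.

(** * A maximum principle and a uniqueness theorem on the upper half-plane *)

Section HalfPlaneUniqueness.
Variable R : realType.
Local Notation C := R[i].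
Implicit Types (G : C -> C) (s z : C).

Lemma is_derive_quadratic (f : R -> R) (x r K : R) : 0 < r ->
  (forall h, `|h| < r -> `|f (x + h) - f x| <= K * h ^+ 2) -> is_derive x (1 : R) f 0.
Proof.
move=> r0 fK.
have cvg0 : (fun h : R => h^-1 *: ((f \o shift x) (h *: (1 : R)) - f x))
    @ (0 : R)^' --> (0 : R).
  apply/cvgrPdist_le => e e0; near=> h.
  have h0 : h != 0 by near: h; exact: nbhs_dnbhs_neq.
  have hr : `|h| < r.
    by near: h; apply: dnbhs0_lt.
  have he : `|h| < e / (`|K| + 1).
    by near: h; apply: dnbhs0_lt; rewrite divr_gt0 // ltr_wpDl.
  rewrite sub0r normrN normrZ normfV /= [h *: 1]mulr1 [h + x]addrC.
  rewrite mulrC ler_pdivrMr ?normr_gt0 //.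
  apply: le_trans (fK h hr) _; rewrite -[h ^+ 2]real_normK ?num_real // expr2 mulrA.
  apply: ler_wpM2r => //; rewrite ltr_pdivlMr ?ltr_wpDl // in he.
  apply: le_trans (ltW he); rewrite mulrC; apply: ler_wpM2l => //.
  by rewrite (le_trans (ler_norm _)) // lerDl.
by apply: DeriveDef; [exact: cvgP cvg0 | exact/cvg_lim].
Unshelve. all: by end_near. Qed.

Lemma quadratic_const (f : R -> R) :
  (forall x, exists r K : R, 0 < r /\
     forall h, `|h| < r -> `|f (x + h) - f x| <= K * h ^+ 2) ->
  forall x y, f x = f y.
Proof.
move=> fK x y; apply: is_derive_0_is_cst => z.
by have [r [K [r0 hK]]] := fK z; apply: is_derive_quadratic r0 hK.
Qed.

Lemma continuous_local_lipschitz (f : R * R -> R) (p : R * R) (r L : R) : 0 < r ->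
  (forall q, `|q.1 - p.1| < r -> `|q.2 - p.2| < r ->
     `|f q - f p| <= L * (`|q.1 - p.1| + `|q.2 - p.2|)) ->
  {for p, continuous f}.
Proof.
move=> r0 fL; apply/cvgrPdist_le => e e0.
have L0 : 0 < 2 * (`|L| + 1) by rewrite mulr_gt0 // ltr_wpDl.
apply/(@nbhs_ballP R (R * R)%type); exists (Num.min r (e / (2 * (`|L| + 1)))) => /=.
  by rewrite lt_min r0 divr_gt0.
move=> q [/=]; rewrite /ball /= !lt_min ![`|p.1 - _|]distrC ![`|p.2 - _|]distrC.
move=> /andP[q1 e1] /andP[q2 e2]; rewrite distrC; apply: le_trans (fL q q1 q2) _.
apply: (le_trans (y := (`|L| + 1) * (e / (2 * (`|L| + 1)) + e / (2 * (`|L| + 1))))).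
  apply: le_trans (_ : (`|L| + 1) * (`|q.1 - p.1| + `|q.2 - p.2|) <= _).
    apply: ler_wpM2r; first by rewrite addr_ge0.
    by rewrite (le_trans (ler_norm _)) // lerDl.
  by apply: ler_wpM2l; rewrite ?addr_ge0 // lerD // ltW.
rewrite le_eqVlt; apply/orP; left; apply/eqP; field.
by rewrite gt_eqF // ltr_wpDl.
Qed.

Definition taylor2 G s := exists c1 c2 (K r : R), 0 < r /\
  forall z, cabs z < r ->
  cabs (G (s + z) - (G s + c1 * z + c2 * z ^+ 2)) <= K * cabs z ^+ 3.

Lemma taylor2N G s : taylor2 G s -> taylor2 (fun z => - G z) s.
Proof.
move=> [c1 [c2 [K [r [r0 GK]]]]]; exists (- c1), (- c2), K, r; split=> // z /GK.
rewrite -cabsN; congr (cabs _ <= _); ring.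
Qed.

Lemma taylor2_lipschitz G s : taylor2 G s ->
  exists L r : R, 0 < r /\ forall z, cabs z < r -> cabs (G (s + z) - G s) <= L * cabs z.
Proof.
move=> [c1 [c2 [K [r [r0 GK]]]]]; exists (cabs c1 + cabs c2 + `|K|), (Num.min r 1).
rewrite lt_min r0 ltr01; split=> // z; rewrite lt_min => /andP[/GK zr z1].
have -> : G (s + z) - G s =
  (G (s + z) - (G s + c1 * z + c2 * z ^+ 2)) + (c1 * z + c2 * z ^+ 2) by ring.
apply: le_trans (cabsD _ _) _; rewrite addrC !mulrDl; apply: lerD.
  apply: le_trans (cabsD _ _) _; rewrite (cabsM c1) (cabsM c2) cabsX lerD2l.
  by rewrite ler_wpM2l ?cabs_ge0 // expr2 ler_piMr ?cabs_ge0 // ltW.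
apply: le_trans zr _; apply: (le_trans (y := `|K| * cabs z ^+ 3)).
  by rewrite ler_wpM2r ?exprn_ge0 ?cabs_ge0 ?ler_norm.
rewrite ler_wpM2l // exprS ler_piMr ?cabs_ge0 //.
by rewrite exprn_ile1 ?cabs_ge0 // ltW.
Qed.

(* The average over s + z, s + iz, s - z, s - iz annihilates the first and
   second order terms. *)
Lemma taylor2_mean G s : taylor2 G s -> exists K r : R, 0 < r /\
  forall d : R, 0 < d -> d < r ->
  4 * complex.Im (G s) - 4 * K * d ^+ 3 <=
    complex.Im (G (s + d%:C%C)) + complex.Im (G (s + (- d)%:C%C))
  + complex.Im (G (s + Complex 0 d)) + complex.Im (G (s + Complex 0 (- d))).
Proof.
move=> [c1 [c2 [K [r [r0 GK]]]]]; exists K, r; split=> // d d0 dr.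
have err z : cabs z = d ->
    complex.Im (G s) + complex.Im (c1 * z + c2 * z ^+ 2) - K * d ^+ 3 <= complex.Im (G (s + z)).
  move=> zd; have := GK z; rewrite zd => /(_ dr) h.
  have := le_trans (ler_Im_cabs _) h; rewrite cImD cImN -addrA cImD => /ler_normlP[h1 _].
  by lra.
have di : cabs (Complex 0 d) = d.
  have -> : Complex 0 d = 'i%C * d%:C%C by apply: complex_eqP; rewrite ?cReM ?cImM /=; ring.
  by rewrite cabsM cabs_i mul1r cabs_real gtr0_norm.
have e1 := err d%:C%C _; rewrite cabs_real gtr0_norm // in e1.
have e2 := err (- d)%:C%C _; rewrite cabs_real normrN gtr0_norm // in e2.
have e3 := err _ di; have e4 := err (Complex 0 (- d)) _.
have dNi : cabs (Complex 0 (- d)) = d.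
  by rewrite -[RHS]di -cabsN; congr cabs; apply: complex_eqP; rewrite /= ?opprK ?oppr0.
have {}e1 := e1 erefl; have {}e2 := e2 erefl; have {}e4 := e4 dNi.
have z0 : complex.Im (c1 * d%:C%C + c2 * d%:C%C ^+ 2)
  + complex.Im (c1 * (- d)%:C%C + c2 * (- d)%:C%C ^+ 2)
  + complex.Im (c1 * Complex 0 d + c2 * Complex 0 d ^+ 2)
  + complex.Im (c1 * Complex 0 (- d) + c2 * Complex 0 (- d) ^+ 2) = 0.
  by rewrite !expr2 !cImD !cImM !cReM /=; ring.
by lra.
Qed.

(** If Im G took a value m > 0, add the strictly subharmonic term eps (Re s)^2, too small to lift
    the values near the boundary up to [m]. The sum then has its maximum on a compact rectangle at
    an interior point. There the four-point mean gains 2 eps d^2 from the added term and loses at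
    most 4 K d^3, a contradiction for small [d]. *)
Lemma half_plane_le0 G : (forall s, 0 < complex.Im s -> taylor2 G s) ->
  (forall M e : R, 0 < e -> exists2 t : R, 0 < t & forall s, 0 < complex.Im s ->
     complex.Im s < t -> `|complex.Re s| <= M -> `|complex.Im (G s)| <= e) ->
  (forall e : R, 0 < e -> exists M : R, forall s, 0 < complex.Im s ->
     M <= cabs s -> cabs (G s) <= e) ->
  forall s, 0 < complex.Im s -> complex.Im (G s) <= 0.
Proof.
move=> taylorG boundary infty s1 s10; rewrite leNgt; apply/negP.
set m := complex.Im (G s1) => m0.
have m20 : 0 < m / 2 by rewrite divr_gt0.
have [M0 M0P] := infty _ m20; pose M := `|M0| + 1.
have M_gt0 : 0 < M by rewrite ltr_wpDl.
have MP s : 0 < complex.Im s -> M <= cabs s -> complex.Im (G s) <= m / 2.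
  move=> sH Ms; apply: le_trans (ler_norm _) _; apply: le_trans (ler_Im_cabs _) _.
  apply: M0P => //; apply: le_trans Ms; rewrite /M.
  by rewrite (le_trans (ler_norm _)) // lerDl.
have [t t0 tP'] := boundary M _ m20.
have tP s : 0 < complex.Im s -> complex.Im s < t -> `|complex.Re s| <= M ->
    complex.Im (G s) <= m / 2.
  by move=> h1 h2 h3; apply: le_trans (ler_norm _) _; apply: tP'.
(* On |Re s| <= M the perturbation is at most m / 4. Where Im G is at most m / 2, the sum therefore
   stays at or below 3m / 4 < m. *)
pose eps := m / (4 * M ^+ 2).
have eps0 : 0 < eps by rewrite divr_gt0 // mulr_gt0 // exprn_gt0.
have epsM x : `|x| <= M -> eps * x ^+ 2 <= m / 4.
  move=> xM; have -> : m / 4 = eps * M ^+ 2.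
    by rewrite /eps; field; rewrite gt_eqF.
  rewrite ler_pM2l // -[x ^+ 2]real_normK ?num_real //.
  by rewrite lerXn2r // nnegrE // ltW.
pose w (p : R * R) := complex.Im (G (Complex p.1 p.2)) + eps * p.1 ^+ 2.
(* The bottom edge is at t / 2 while a maximizer has height at least [t]: this leaves room for a
   step downwards. *)
pose A := (`[- M, M] `*` `[t / 2, M])%classic : set (R * R).
have memA p : p \in A = (`|p.1| <= M) && (t / 2 <= p.2 <= M).
  rewrite /A ler_norml; apply/idP/idP => [|/andP[h1 h2]]; rewrite inE /= !in_itv /=.
    by move=> [-> ->].
  by split.
have interior s : 0 < complex.Im s -> `|complex.Re s| <= M ->
    m <= complex.Im (G s) + eps * complex.Re s ^+ 2 -> t <= complex.Im s /\ cabs s < M.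
  move=> s0 sM ms; have := epsM _ sM; split.
    by rewrite leNgt; apply/negP => /(tP _ s0)/(_ sM); lra.
  by rewrite ltNge; apply/negP => /(MP _ s0); lra.
have cabs_lt s : cabs s < M -> `|complex.Re s| < M /\ `|complex.Im s| < M.
  by move=> sM; split; apply: le_lt_trans sM; rewrite ?ler_Re_cabs ?ler_Im_cabs.
have ws1 : m <= complex.Im (G s1) + eps * complex.Re s1 ^+ 2.
  by rewrite -/m lerDl mulr_ge0 ?sqr_ge0 // ltW.
have s1M : cabs s1 < M.
  by rewrite ltNge; apply/negP => /(MP _ s10); rewrite -/m; lra.
have [s1Re s1Im] := cabs_lt _ s1M.
have [ts1 _] := interior s1 s10 (ltW s1Re) ws1.
have As1 : (complex.Re s1, complex.Im s1) \in A.
  rewrite memA /= (ltW s1Re) /=; apply/andP; split; first by lra.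
  by apply: le_trans (ltW s1Im); exact: ler_norm.
have [|||p pA pmax] := @compact_EVT_max _ R w A.
- by exists (complex.Re s1, complex.Im s1); rewrite -inE.
- by apply: compact_setX; exact: segment_compact.
- apply: continuous_in_subspaceT => p; rewrite memA => /and3P[_ p2 _].
  have p20 : 0 < p.2 by lra.
  have [L [r [r0 GL]]] := taylor2_lipschitz (taylorG (Complex p.1 p.2) p20).
  apply: cvgD; last first.
    apply: cvgM; first exact: cvg_cst.
    by apply: (@cvgM _ _ _ _ (fun q : R * R => q.1) (fun q : R * R => q.1)); exact: cvg_fst.
  apply: (@continuous_local_lipschitz _ p (r / 2) `|L|) => [|q q1 q2].
    by rewrite divr_gt0.
  pose z := Complex (q.1 - p.1) (q.2 - p.2).
  have zE : Complex q.1 q.2 = Complex p.1 p.2 + z.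
    by apply: complex_eqP; rewrite ?cReD ?cImD /= addrC subrK.
  have zle := cabs_le_ReIm z; rewrite /= in zle.
  have zr : cabs z < r by lra.
  rewrite zE -cImN -cImD; apply: le_trans (ler_Im_cabs _) _.
  apply: le_trans (GL z zr) _; apply: (le_trans (y := `|L| * cabs z)).
    by rewrite ler_wpM2r ?cabs_ge0 ?ler_norm.
  by rewrite ler_wpM2l.
have := pA; rewrite memA => /and3P[p1M p2t p2M].
have p20 : 0 < p.2 by lra.
have s1E : Complex (complex.Re s1) (complex.Im s1) = s1 by apply: complex_eqP.
have wp : m <= w p.
  by have := pmax _ As1; rewrite {1}/w /= s1E; apply: le_trans.
have [tp pM] := interior (Complex p.1 p.2) p20 p1M wp.
have [/= p1M' p2M'] := cabs_lt _ pM.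
have {}p2M' := le_lt_trans (ler_norm _) p2M'.
have [K [r [r0 mean]]] := taylor2_mean (taylorG (Complex p.1 p.2) p20).
(* The four test points must stay in the rectangle and in the Taylor disc; the last term gives 2 K d
   < eps. *)
pose d := Num.min (Num.min (r / 2) (t / 2))
  (Num.min (Num.min (M - `|p.1|) (M - p.2)) (eps / (4 * (`|K| + 1)))).
have d0 : 0 < d.
  have K4 : 0 < 4 * (`|K| + 1) by rewrite mulr_gt0 // ltr_wpDl.
  rewrite !lt_min !subr_gt0 p1M' p2M' /=; apply/andP; split; last exact: divr_gt0.
  by rewrite (divr_gt0 r0) // (divr_gt0 t0).
have : d <= d by []; rewrite {2}/d !le_min => /andP[/andP[dr dt] /andP[/andP[d1 d2] dK]].
have {}dr : d < r by lra.
have dK' : 2 * K * d < eps.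
  have K1 : 0 < `|K| + 1 by rewrite ltr_wpDl.
  have : d * (`|K| + 1) <= eps / 4.
    have -> : eps / 4 = eps / (4 * (`|K| + 1)) * (`|K| + 1) by field; rewrite gt_eqF.
    by rewrite ler_pM2r.
  have : K * d <= (`|K| + 1) * d.
    by rewrite ler_wpM2r ?(ltW d0) // (le_trans (ler_norm _)) // lerDl.
  by lra.
have := mean d d0 dr.
have /pmax : (p.1 + d, p.2) \in A.
  by rewrite memA /= p2t p2M !andbT (le_trans (ler_normD _ _)) // (gtr0_norm d0); lra.
have /pmax : (p.1 - d, p.2) \in A.
  by rewrite memA /= p2t p2M !andbT (le_trans (ler_normB _ _)) // (gtr0_norm d0); lra.
have /pmax : (p.1, p.2 + d) \in A.
  by rewrite memA /= p1M /=; apply/andP; split; lra.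
have /pmax : (p.1, p.2 - d) \in A.
  by rewrite memA /= p1M /=; apply/andP; split; lra.
rewrite /w /=.
have -> : Complex p.1 p.2 + d%:C%C = Complex (p.1 + d) p.2.
  by apply: complex_eqP; rewrite ?cReD ?cImD /= ?addr0.
have -> : Complex p.1 p.2 + (- d)%:C%C = Complex (p.1 - d) p.2.
  by apply: complex_eqP; rewrite ?cReD ?cImD /= ?addr0.
have -> : Complex p.1 p.2 + Complex 0 d = Complex p.1 (p.2 + d).
  by apply: complex_eqP; rewrite ?cReD ?cImD /= ?addr0.
have -> : Complex p.1 p.2 + Complex 0 (- d) = Complex p.1 (p.2 - d).
  by apply: complex_eqP; rewrite ?cReD ?cImD /= ?addr0.
have : 2 * K * d * d ^+ 2 < eps * d ^+ 2 by rewrite ltr_pM2r // exprn_gt0.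
have -> : d ^+ 3 = d * d ^+ 2 by rewrite exprS.
clear; nra.
Qed.

(** The maximum principle for [G] and for [- G] makes [G] real. A real-valued function with such
    expansions has no first-order term, so its increments are quadratic and it is constant along
    vertical rays; its decay at infinity then forces 0. *)
Lemma half_plane_eq0 G : (forall s, 0 < complex.Im s -> taylor2 G s) ->
  (forall M e : R, 0 < e -> exists2 t : R, 0 < t & forall s, 0 < complex.Im s ->
     complex.Im s < t -> `|complex.Re s| <= M -> `|complex.Im (G s)| <= e) ->
  (forall e : R, 0 < e -> exists M : R, forall s, 0 < complex.Im s ->
     M <= cabs s -> cabs (G s) <= e) ->
  forall s, 0 < complex.Im s -> G s = 0.
Proof.
move=> taylorG boundary infty.
have ImG s : 0 < complex.Im s -> complex.Im (G s) = 0.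
  move=> s0; apply/eqP; rewrite eq_le half_plane_le0 //=.
  rewrite -oppr_le0 -cImN (@half_plane_le0 (fun z => - G z)) //.
  - by move=> z z0; apply/taylor2N/taylorG.
  - move=> M e e0; have [t t0 tP] := boundary M e e0; exists t => // z z0 zt zM.
    by rewrite cImN normrN tP.
  - move=> e e0; have [M MP] := infty e e0; exists M => z z0 zM.
    by rewrite cabsN MP.
have flat s : 0 < complex.Im s -> exists K r : R, 0 < r /\
    forall z, cabs z < r -> cabs (G (s + z) - G s) <= K * cabs z ^+ 2.
  move=> s0; have [c1 [c2 [K [r [r0 GK]]]]] := taylorG s s0.
  pose r1 := Num.min r (complex.Im s).
  have r10 : 0 < r1 by rewrite lt_min r0.
  (* Comparing the expansions at z and at -z cancels the second-order term. *)
  have odd z : cabs z < r1 -> `|complex.Im (c1 * z)| <= K * cabs z ^+ 3.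
    rewrite lt_min => /andP[zr zs].
    have up y : cabs y = cabs z -> complex.Im (G (s + y)) = 0.
      move=> yz; apply: ImG; rewrite cImD.
      by have := ler_Im_cabs y; rewrite yz => /ler_normlP[h1 h2]; lra.
    have h1 := le_trans (ler_Im_cabs _) (GK z zr).
    have zNr : cabs (- z) < r by rewrite cabsN.
    have h2 := le_trans (ler_Im_cabs _) (GK (- z) zNr).
    rewrite cabsN sqrrN in h2; move: h1 h2.
    rewrite !cImD !cImN !cImD !up ?cabsN // (ImG s) // mulrN cImN.
    move=> /ler_normlP[h1 h2] /ler_normlP[h3 h4].
    by apply/ler_normlP; split; lra.
  have small (a : R) : (forall d : R, 0 < d -> d < r1 -> a * d <= K * d ^+ 3) -> a <= 0.
    move=> h; rewrite leNgt; apply/negP => a0.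
    pose d := Num.min (r1 / 2) (Num.min 1 (a / (2 * (`|K| + 1)))).
    have K1 : 0 < `|K| + 1 by rewrite ltr_wpDl.
    have d0 : 0 < d by rewrite !lt_min ltr01 !divr_gt0 // mulr_gt0.
    have : d <= d by []; rewrite {2}/d !le_min => /and3P[d1 d2 d3].
    have := h d d0; have {}d1 : d < r1 by lra.
    move=> /(_ d1); rewrite [d ^+ 3]exprSr mulrA ler_pM2r //; apply/negP.
    rewrite -ltNge; apply: le_lt_trans (_ : (`|K| + 1) * d < _).
      apply: (le_trans (y := `|K| * d ^+ 2)).
        by rewrite ler_wpM2r ?sqr_ge0 ?ler_norm.
      by apply: ler_pM; rewrite ?sqr_ge0 ?lerDl // expr2 ler_piMr // ltW.
    apply: le_lt_trans (_ : (`|K| + 1) * (a / (2 * (`|K| + 1))) < _).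
      by rewrite ler_pM2l.
    have -> : (`|K| + 1) * (a / (2 * (`|K| + 1))) = a / 2 by field; rewrite gt_eqF.
    by lra.
  have c10 : c1 = 0.
    apply: complex_eqP => /=.
      apply/eqP; rewrite -normr_eq0 eq_le normr_ge0 andbT; apply: small => d d0 dr.
      have di : cabs ('i%C * d%:C%C : C) = d.
        by rewrite cabsM cabs_i mul1r cabs_real gtr0_norm.
      have := odd ('i%C * d%:C%C); rewrite di => /(_ dr).
      have -> : complex.Im (c1 * ('i%C * d%:C%C)) = complex.Re c1 * d.
        by rewrite !cImM !cReM /=; ring.
      by rewrite normrM (gtr0_norm d0).
    apply/eqP; rewrite -normr_eq0 eq_le normr_ge0 andbT; apply: small => d d0 dr.
    have := odd d%:C%C; rewrite cabs_real (gtr0_norm d0) => /(_ dr).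
    have -> : complex.Im (c1 * d%:C%C) = complex.Im c1 * d by rewrite cImM /=; ring.
    by rewrite normrM (gtr0_norm d0).
  exists (cabs c2 + `|K|), (Num.min r 1); rewrite lt_min r0 ltr01; split=> // z.
  rewrite lt_min => /andP[/GK zr z1].
  have -> : G (s + z) - G s =
    (G (s + z) - (G s + c1 * z + c2 * z ^+ 2)) + c2 * z ^+ 2 by rewrite c10; ring.
  apply: le_trans (cabsD _ _) _; rewrite addrC mulrDl (cabsM c2) cabsX lerD2l.
  apply: le_trans zr _; apply: (le_trans (y := `|K| * cabs z ^+ 3)).
    by rewrite ler_wpM2r ?exprn_ge0 ?cabs_ge0 ?ler_norm.
  rewrite ler_wpM2l // exprSr ler_piMr ?exprn_ge0 ?cabs_ge0 //.
  exact: ltW.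
move=> s s0; apply: complex_eqP => /=; last exact: ImG.
(* The absolute value keeps the argument in the half-plane for every real [x], so that
   [quadratic_const] applies on the whole line. *)
pose f (x : R) := complex.Re (G (s + Complex 0 `|x|)).
have fcst x y : f x = f y.
  apply: quadratic_const => {}x.
  have sx0 : 0 < complex.Im (s + Complex 0 `|x|) by rewrite cImD /= ltr_wpDr.
  have [K [r [r0 GK]]] := flat _ sx0; exists r, `|K|; split=> // h hr.
  pose z : C := Complex 0 (`|x + h| - `|x|).
  have sz : s + Complex 0 `|x + h| = s + Complex 0 `|x| + z.
    by apply: complex_eqP; rewrite !(cReD, cImD) /=; ring.
  have zh : cabs z <= `|h|.
    apply: le_trans (cabs_le_ReIm _) _; rewrite /= normr0 add0r.
    by have := ler_dist_dist (x + h) x; rewrite addrAC subrr add0r.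
  rewrite /f sz -cReN -cReD; apply: le_trans (ler_Re_cabs _) _.
  apply: le_trans (GK _ (le_lt_trans zh hr)) _.
  rewrite -[h ^+ 2]real_normK ?num_real //.
  apply: (le_trans (y := `|K| * cabs z ^+ 2)).
    by rewrite ler_wpM2r ?exprn_ge0 ?cabs_ge0 ?ler_norm.
  by rewrite ler_wpM2l // lerXn2r ?nnegrE ?cabs_ge0.
apply/eqP; rewrite -normr_eq0; apply/eqP/le_anti; rewrite normr_ge0 andbT.
apply/ler_addgt0Pr => e e0; rewrite add0r; have [M MP] := infty e e0.
have -> : complex.Re (G s) = f `|M|.
  rewrite -[LHS]/(complex.Re (G s)) (fcst _ 0) /f normr0; congr (complex.Re (G _)).
  by apply: complex_eqP; rewrite !(cReD, cImD) /= addr0.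
apply: le_trans (ler_Re_cabs _) _; apply: MP; first by rewrite cImD /= ltr_wpDr.
apply: le_trans (ler_Im_cabs _); rewrite cImD /= normr_id ger0_norm; last first.
  by rewrite addr_ge0 // ltW.
by rewrite (le_trans (ler_norm M)) // lerDr ltW.
Qed.

End HalfPlaneUniqueness.

(** * Restrictions of a form to lines and pencils, with degree bounds *)

Section MmapTheory.
Variables (n : nat) (R : comNzRingType).
Implicit Types (h : {mpoly R[n]}) (d : nat).

Lemma rmorph_mmap (S T : comNzRingType) (phi : {rmorphism S -> T})
    (f : R -> S) (X : 'I_n -> S) h :
  phi (mmap f X h) = mmap (phi \o f) (phi \o X) h.
Proof.
rewrite /mmap rmorph_sum; apply: eq_bigr => m _.
rewrite rmorphM /mmap1 rmorph_prod; congr (_ * _).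
by apply: eq_bigr => i _; rewrite rmorphXn.
Qed.

Lemma mmap1_scale (S : comNzRingType) (c : S) (X : 'I_n -> S) m :
  mmap1 (fun i => c * X i) m = c ^+ mdeg m * mmap1 X m.
Proof.
rewrite /mmap1 mdegE -prodrXr -big_split /=.
by apply: eq_bigr => i _; rewrite exprMn.
Qed.

Lemma mmap_scale (S : comNzRingType) (f : R -> S) (c : S) (X : 'I_n -> S) h d :
  h \is ishomog1 d mdeg ->
  mmap f (fun i => c * X i) h = c ^+ d * mmap f X h.
Proof.
move/dhomogP => hd; rewrite /mmap mulr_sumr big_seq [RHS]big_seq.
by apply: eq_bigr => m /hd md; rewrite mmap1_scale (md : mdeg m = d) mulrCA.
Qed.

(* Total degree in both variables at most [d]; [c] is the coefficient of the
   [d]-th power of the inner variable. *)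
Definition bidegree_le (S : comNzRingType) d (P : {poly {poly S}}) (c : S) :=
  (forall i, (size (P`_i)%R <= d.+1 - i)%N) /\ (P`_0)`_d = c.

Section Bidegree.
Variable S : comNzRingType.
Implicit Types (P Q : {poly {poly S}}) (c : S).

Lemma bidegree_leC c : bidegree_le 0 c%:P%:P c.
Proof.
split=> [i|]; last by rewrite !coefC.
by rewrite coefC; case: i => [|i]; rewrite ?size_poly0 ?size_polyC_leq1.
Qed.

Lemma bidegree_leD d P Q c c' : bidegree_le d P c -> bidegree_le d Q c' ->
  bidegree_le d (P + Q) (c + c').
Proof.
move=> [sP <-] [sQ <-]; split=> [i|]; last by rewrite !coefD.
by rewrite coefD (leq_trans (size_polyD _ _)) // geq_max sP sQ.
Qed.

Lemma coef_mul_top (p q : {poly S}) d e : (size p <= d.+1)%N -> (size q <= e.+1)%N ->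
  (p * q)`_(d + e) = p`_d * q`_e.
Proof.
move=> sp sq; rewrite coefM.
have lt_d : (d < (d + e).+1)%N by rewrite ltnS leq_addr.
rewrite (bigD1 (Ordinal lt_d)) //= addKn big1 ?addr0 // => i.
rewrite -val_eqE /= neq_ltn => /orP[lt_id|lt_di].
  rewrite [q`__]nth_default ?mulr0 // (leq_trans sq) //.
  by rewrite ltn_subRL ltn_add2r.
by rewrite nth_default ?mul0r // (leq_trans sp).
Qed.

Lemma leq_predD_sub (a b d e i j : nat) : (0 < a)%N -> (0 < b)%N -> (j < i.+1)%N ->
  (a <= d.+1 - j)%N -> (b <= e.+1 - (i - j))%N -> ((a + b).-1 <= (d + e).+1 - i)%N.
Proof. lia. Qed.

Lemma bidegree_leM d e P Q c c' : bidegree_le d P c -> bidegree_le e Q c' ->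
  bidegree_le (d + e) (P * Q) (c * c').
Proof.
move=> [sP <-] [sQ <-]; split=> [i|]; last first.
  by rewrite coef0M coef_mul_top // -?(subn0 d.+1) -?(subn0 e.+1).
rewrite coefM; apply: (big_ind (fun p : {poly S} => (size p <= (d + e).+1 - i)%N)) => [|p q sp sq|j _].
- by rewrite size_poly0.
- by rewrite (leq_trans (size_polyD _ _)) // geq_max sp.
have [->|p0] := eqVneq (P`_j) 0; first by rewrite mul0r size_poly0.
have [->|q0] := eqVneq (Q`_(i - j)) 0; first by rewrite mulr0 size_poly0.
apply: leq_trans (size_polyMleq _ _) _.
by apply: (@leq_predD_sub _ _ d e i j); rewrite ?size_poly_gt0.
Qed.

Lemma bidegree_leX d P c k : bidegree_le d P c -> bidegree_le (d * k) (P ^+ k) (c ^+ k).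
Proof.
move=> dP; elim: k => [|k IHk]; first by rewrite muln0 !expr0; apply: bidegree_leC.
by rewrite mulnS !exprS; apply: bidegree_leM.
Qed.

(** Each linear form has total degree at most 1 with inner coefficient X_i, and homogeneity adds
    this up over every monomial. The two conclusions give what Hensel lifting needs after division
    by h(X): a monic constant term and strictly lower inner degree at higher powers of the
    parameter. *)
Lemma bidegree_le_mmap (f : R -> S) (X Y W : 'I_n -> S) h d :
  h \is ishomog1 d mdeg ->
  bidegree_le d
    (mmap (fun a => (f a)%:P%:P) (fun i => (X i *: 'X + (W i)%:P)%:P + (Y i)%:P *: 'X) h)
    (mmap f X h).
Proof.
move/dhomogP => hd; rewrite /mmap big_seq [X in bidegree_le _ _ X]big_seq.
apply: (big_ind2 (bidegree_le d)) => [|P c Q c' dP dQ|m /hd md].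
- by split=> [i|]; rewrite !coef0 ?size_poly0.
- exact: bidegree_leD.
rewrite -(add0n d) -(md : mdeg m = d) mdegE /mmap1; apply: bidegree_leM; first exact: bidegree_leC.
elim/big_rec3: _ => [|i e c P _ dP]; first exact: bidegree_leC.
apply: bidegree_leM dP; rewrite -[X in bidegree_le X _ _]mul1n; apply: bidegree_leX.
split=> [[|[|k]]|].
- rewrite coefD coefC coefZ coefX mulr0 addr0 /= subn0.
  rewrite (leq_trans (size_polyD _ _)) // geq_max.
  by rewrite (leq_trans (size_scale_leq _ _)) ?size_polyX // (leq_trans (size_polyC_leq1 _)).
- by rewrite coefD coefC coefZ coefX mulr1 add0r /= size_polyC_leq1.
- by rewrite coefD coefC coefZ coefX mulr0 addr0 size_poly0.
rewrite coefD coefC /= coefZ coefX /= mulr0 addr0.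
by rewrite coefD coefZ coefX coefC /= mulr1 addr0.
Qed.

End Bidegree.

Section Pencil.
Variables (S : comNzRingType) (iota : {rmorphism R -> S}) (h : {mpoly R[n]}).
Implicit Types (X Y W : 'I_n -> S).

(** h(tX + W) over an arbitrary coefficient ring; it is instantiated with the reals, the complex
    numbers and the polynomials in [v]. *)
Definition linep X W : {poly S} :=
  mmap (polyC \o iota) (fun i => X i *: 'X + (W i)%:P) h.

(* The outer variable is the coefficient of [Y], the inner one that of [X]. *)
Definition pencil X Y W : {poly {poly S}} :=
  mmap (fun a => (iota a)%:P%:P) (fun i => (X i *: 'X + (W i)%:P)%:P + (Y i)%:P *: 'X) h.

Lemma linepE X W t : (linep X W).[t] = mmap iota (fun i => t * X i + W i) h.
Proof.
rewrite -/(horner_eval t _) rmorph_mmap /mmap; apply: eq_bigr => m _ /=.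
rewrite /horner_eval hornerC; congr (_ * _); apply: eq_bigr => i _ /=.
by rewrite hornerD hornerZ hornerX hornerC mulrC.
Qed.

Lemma pencilE X Y W z : (pencil X Y W).[z%:P] = linep X (fun i => z * Y i + W i).
Proof.
rewrite -/(horner_eval z%:P _) rmorph_mmap /linep /mmap; apply: eq_bigr => m _ /=.
rewrite /horner_eval hornerC; congr (_ * _); apply: eq_bigr => i _ /=.
rewrite hornerD hornerZ hornerX hornerC polyCD polyCM; congr (_ ^+ _); ring.
Qed.

Lemma pencil_coef0 X Y W : (pencil X Y W)`_0 = linep X W.
Proof.
rewrite -horner_coef0 -polyC0 pencilE; apply: eq_bigr => m _; congr (_ * _).
by apply: eq_bigr => i _; rewrite mul0r add0r.
Qed.

End Pencil.

Lemma map_pencil (S T : comNzRingType) (f : {rmorphism R -> S}) (g : {rmorphism R -> T})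
    (phi : {rmorphism S -> T}) h (X Y W : 'I_n -> S) : (forall a, phi (f a) = g a) ->
  map_poly (map_poly phi) (pencil f h X Y W) =
  pencil g h (phi \o X) (phi \o Y) (phi \o W).
Proof.
move=> fg; rewrite rmorph_mmap /pencil /mmap; apply: eq_bigr => m _ /=.
rewrite map_polyC /= map_polyC /= fg; congr (_ * _); apply: eq_bigr => i _ /=.
rewrite rmorphD /= map_polyC /= rmorphD /= map_polyZ map_polyX map_polyC.
by rewrite map_polyZ map_polyX /= map_polyC.
Qed.

End MmapTheory.

(** Embedded in the reals, such a function has locally zero increments, so [quadratic_const]
    applies. This replaces continuity arguments when counting roots. *)
Lemma locally_const_nat (R : realType) (f : R -> nat) :
  (forall x : R, exists2 r : R, 0 < r & forall y, `|y| < r -> f (x + y) = f x) ->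
  forall x y, f x = f y.
Proof.
move=> fl x y; apply/eqP; rewrite -(eqr_nat R); apply/eqP.
apply: (@quadratic_const R (fun x => (f x)%:R)) => {}x.
have [r r0 fr] := fl x; exists r, 0; split=> // z zr.
by rewrite fr // subrr normr0 mul0r.
Qed.

(** * Hyperbolicity in terms of complex values of the form *)

Section Hyperbolicity.
Variables (R : realType) (n d : nat) (h : {mpoly R[n]}).
Hypothesis hd : h \is ishomog1 d mdeg.
Local Notation C := R[i].
Local Notation rc := (real_complex R).
Implicit Types (e v w x : 'I_n -> R) (X Y Z W : 'I_n -> C) (s t z : C).

Definition hval Z : C := mmap rc Z h.
Definition cvec v : 'I_n -> C := fun i => (v i)%:C%C.
(** Roots are expressed by the vanishing of complex values of [h], so vectors can be rescaled and
    recombined pointwise; [hyperbolic_wrtP] links this to the definition by univariate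
    polynomials. *)
Definition hyp e := hval (cvec e) != 0 /\
  forall v z, hval (fun i => z * cvec e i + cvec v i) = 0 -> complex.Im z = 0.

Lemma hval_ext Z W : Z =1 W -> hval Z = hval W.
Proof. by move=> /funext ->. Qed.

Lemma hval_scale c Z : hval (fun i => c * Z i) = c ^+ d * hval Z.
Proof. exact: mmap_scale. Qed.

Lemma hval_scale_eq0 c Z : c != 0 -> (hval (fun i => c * Z i) == 0) = (hval Z == 0).
Proof. by move=> c0; rewrite hval_scale mulf_eq0 expf_eq0 (negPf c0) andbF. Qed.

Lemma hval_real v : hval (cvec v) = (meval v h)%:C%C.
Proof.
rewrite /meval rmorph_mmap /hval /mmap; apply: eq_bigr => m _.
by congr (_ * _); apply: eq_bigr.
Qed.

Lemma hval_conj Z : hval (fun i => (Z i)^*%C) = (hval Z)^*%C.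
Proof.
rewrite /hval rmorph_mmap /mmap; apply: eq_bigr => m _.
by congr (_ * _); apply: complex_eqP; rewrite /= ?oppr0.
Qed.

Lemma hyperbolic_wrtP (e : 'rV[R]_n) : hyperbolic_wrt h e <-> hyp (e ord0).
Proof.
rewrite /hyperbolic_wrt /hyp hval_real.
have rE (u : 'rV[R]_n) z : root (map_poly rc (line_poly h e u)) z =
    (hval (fun i => z * cvec (e ord0) i + cvec (u ord0) i) == 0).
  rewrite rootE -/(horner_eval z _) /line_poly -[map_poly rc _]/(map_poly rc _).
  rewrite rmorph_mmap /= rmorph_mmap /hval /mmap; congr (_ == _).
  apply: eq_bigr => m _ /=; rewrite /horner_eval map_polyC hornerC.
  congr (_ * _); apply: eq_bigr => i _ /=.
  rewrite rmorphD /= map_polyZ map_polyX map_polyC hornerD hornerZ hornerX hornerC.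
  by rewrite mulrC.
split=> -[h0 hr]; split=> [|v z].
- by rewrite fmorph_eq0.
- move=> hz; apply: (hr (\row_i v i)); rewrite rE; apply/eqP; rewrite -hz.
  by apply: hval_ext => i; rewrite /cvec mxE.
- by move: h0; rewrite fmorph_eq0.
- by rewrite rE => /eqP /hr.
Qed.

(** h(X) is the coefficient of t^d, so when it is nonzero this multiple is monic. *)
Definition nline X W : {poly C} := (hval X)^-1 *: linep rc h X W.
Definition npencil X Y W : {poly {poly C}} := ((hval X)^-1)%:P *: pencil rc h X Y W.

Lemma nlineE X W t : (nline X W).[t] = (hval X)^-1 * hval (fun i => t * X i + W i).
Proof. by rewrite hornerZ linepE. Qed.

Lemma npencilE X Y W z : (npencil X Y W).[z%:P] = nline X (fun i => z * Y i + W i).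
Proof. by rewrite hornerZ pencilE mul_polyC. Qed.

Lemma npencil_coef0 X Y W : (npencil X Y W)`_0 = nline X W.
Proof. by rewrite coefZ pencil_coef0 mul_polyC. Qed.

Lemma root_nline X W t : hval X != 0 ->
  root (nline X W) t = (hval (fun i => t * X i + W i) == 0).
Proof. by move=> X0; rewrite rootE nlineE mulf_eq0 invr_eq0 (negPf X0). Qed.

Lemma pencil_bidegree X Y W : bidegree_le d (pencil rc h X Y W) (hval X).
Proof. exact: bidegree_le_mmap. Qed.

Lemma nline_size_monic X W : hval X != 0 ->
  size (nline X W) = d.+1 /\ nline X W \is monic.
Proof.
move=> X0; have [sP top] := pencil_bidegree X (fun=> 0) W.
have /leq_sizeP sl := sP 0%N.
have le_d : (size (nline X W) <= d.+1)%N.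
  rewrite (leq_trans (size_scale_leq _ _)) //.
  by have := sP 0%N; rewrite pencil_coef0 subn0.
have ld : (nline X W)`_d = 1.
  by rewrite coefZ -(pencil_coef0 rc h X (fun=> 0) W) top mulVf.
have sd : size (nline X W) = d.+1.
  apply/eqP; rewrite eqn_leq le_d ltnNge; apply/negP => /leq_sizeP/(_ d (leqnn d)).
  by move/eqP; rewrite ld oner_eq0.
by split=> //; rewrite monicE lead_coefE sd /= ld.
Qed.

Lemma npencil_size X Y W i : hval X != 0 -> (0 < i)%N ->
  (size ((npencil X Y W)`_i)%R < size ((npencil X Y W)`_0)%R)%N.
Proof.
move=> X0 i0; rewrite npencil_coef0 (nline_size_monic W X0).1 ltnS coefZ mul_polyC.
rewrite (leq_trans (size_scale_leq _ _)) // (leq_trans ((pencil_bidegree X Y W).1 i)) //.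
by case: i i0 => // i _; rewrite subSS leq_subr.
Qed.

Lemma npencil_monic X Y W : hval X != 0 -> (npencil X Y W)`_0 \is monic.
Proof. by move=> X0; rewrite npencil_coef0 (nline_size_monic W X0).2. Qed.

(** A polynomial size, hence one more than the number of roots in the upper half-plane: the value 1
    means that there are none. *)
Definition nupper X W := size (upper_part (nline X W)).

Lemma nupper_local X Y W z0 : hval X != 0 ->
  (forall t, hval (fun i => t * X i + (z0 * Y i + W i)) = 0 -> complex.Im t != 0) ->
  exists (a : {poly {poly C}}) (r K : R), [/\ 0 < r, 0 <= K & forall z, cabs z < r ->
    (forall t, hval (fun i => t * X i + ((z0 + z) * Y i + W i)) = 0 -> complex.Im t != 0) ->
    nupper X (fun i => (z0 + z) * Y i + W i) = nupper X (fun i => z0 * Y i + W i) /\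
    pnorm (upper_part (nline X (fun i => (z0 + z) * Y i + W i)) - a.[z%:P])
      <= K * cabs z ^+ 3].
Proof.
move=> X0 hr; pose W0 i := z0 * Y i + W i.
have shift z : (npencil X Y W0).[z%:P] = nline X (fun i => (z0 + z) * Y i + W i).
  by rewrite npencilE; congr nline; apply/funext => i; rewrite /W0; ring.
have [|a [r [K [r0 K0 loc]]]] :=
    upper_part_local (npencil_monic Y W0 X0) (fun i => npencil_size Y W0 X0 (i := i)).
- by move=> t; rewrite npencil_coef0 root_nline // => /eqP/hr.
exists a, r, K; split=> // z zr hz.
have := loc z zr; rewrite shift npencil_coef0; apply=> t.
by rewrite root_nline // => /eqP/hz.
Qed.

End Hyperbolicity.

(** * Garding's theorem and its consequences for roots *)

Section Garding.
Variables (R : realType) (n d : nat) (h : {mpoly R[n]}).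
Hypothesis hd : h \is ishomog1 d mdeg.
Local Notation C := R[i].
Local Notation hval := (hval h).
Local Notation hyp := (hyp h).
Implicit Types (e v w x : 'I_n -> R) (X Y Z W : 'I_n -> C) (s t z : C).

Lemma hyp_tube e v z : hyp e -> complex.Im z != 0 ->
  hval (fun i => z * cvec e i + cvec v i) != 0.
Proof. by move=> [_ he] z0; apply: contra z0 => /eqP/he ->. Qed.

(** For real [t] the term tx could be absorbed into the real vector [v], leaving [s] as a non-real
    root in direction [e]. *)
Lemma hyp_nonreal e v x s t : hyp e -> complex.Im s != 0 ->
  hval (fun i => t * cvec x i + (s * cvec e i + cvec v i)) = 0 -> complex.Im t != 0.
Proof.
move=> he s0 /eqP; apply: contraTneq => t0.
have := hyp_tube (fun i => complex.Re t * x i + v i) he s0.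
congr (_ != _); apply: hval_ext => i; apply: complex_eqP;
  rewrite !(cReD, cImD, cReM, cImM) /= t0; ring.
Qed.

(** Scale [v] by a real factor a running from 1 to 0: no root in t of h(tx + ie + av) ever meets the
    real axis, so the number of upper roots stays constant. *)
Lemma nupper_const e x v : hyp e -> hval (cvec x) != 0 ->
  nupper h (cvec x) (fun i => 'i%C * cvec e i + cvec v i) =
  nupper h (cvec x) (fun i => 'i%C * cvec e i).
Proof.
move=> he x0.
pose f (a : R) := nupper h (cvec x) (fun i => a%:C%C * cvec v i + 'i%C * cvec e i).
have nr (a : R) t :
    hval (fun i => t * cvec x i + (a%:C%C * cvec v i + 'i%C * cvec e i)) = 0 ->
    complex.Im t != 0.
  move=> ht; apply: (@hyp_nonreal e (fun i => a * v i) x 'i%C t) => //.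
    exact: oner_neq0.
  rewrite -[RHS]ht; apply: hval_ext => i; rewrite /cvec rmorphM /=; ring.
have fcst : f 1 = f 0.
  apply: locally_const_nat => a.
  have [b [r [K [r0 _ loc]]]] := nupper_local hd x0 (nr a).
  exists r; first exact: r0.
  move=> y yr; have := loc y%:C%C; rewrite cabs_real => /(_ yr) [].
    by move=> t ht; apply: (nr (a + y) t); rewrite rmorphD.
  by rewrite /f rmorphD.
transitivity (f 1); last rewrite fcst /f.
  by congr (nupper _ _ _); apply/funext => i; rewrite mul1r addrC.
by congr (nupper _ _ _); apply/funext => i; rewrite mul0r add0r.
Qed.

Lemma nupper0P X W : hval X != 0 -> nupper h X W = 1%N <->
  forall t, hval (fun i => t * X i + W i) = 0 -> ~~ (0 < complex.Im t).
Proof.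
move=> X0; have n0 := monic_neq0 (nline_size_monic hd W X0).2.
rewrite /nupper size_upper_part; split=> [[/size0nil u0] t ht|ht].
  have := mem_upper_roots t n0; rewrite u0 in_nil root_nline // ht eqxx /=.
  by move=> <-.
congr S; apply/eqP; rewrite size_eq0; case E: (upper_roots _) => [//|t r].
have := mem_upper_roots t n0; rewrite E mem_head root_nline //.
by move/esym/andP => [/eqP/ht/negPf->].
Qed.

(** By homogeneity the roots of h(tx + ie) are i/y with y a root of h(ye + x), hence real and
    negative, so they lie in the lower half-plane. By [nupper_const] this persists after adding any
    real [v], by scaling it holds with ib in place of i for b > 0, and b tending to 0 leaves roots
    of h(tx + v) with nonpositive imaginary part. Conjugation gives the other inequality. *)
Lemma garding e x : hyp e ->
  (forall t, hval (fun i => t * cvec e i + cvec x i) = 0 -> complex.Re t < 0) ->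
  hyp x.
Proof.
move=> he hx; have he0 := he.1.
have x0 : hval (cvec x) != 0.
  apply/negP => /eqP hx0; have : complex.Re (0 : C) < 0; last by rewrite /= ltxx.
  by apply: hx; rewrite -[RHS]hx0; apply: hval_ext => i; rewrite mul0r add0r.
have lower v t : hval (fun i => t * cvec x i + ('i%C * cvec e i + cvec v i)) = 0 ->
    complex.Im t < 0.
  move=> ht; rewrite lt_neqAle (hyp_nonreal he _ ht) ?oner_neq0 //= leNgt.
  have /nupper0P : nupper h (cvec x) (fun i => 'i%C * cvec e i + cvec v i) = 1%N.
    rewrite nupper_const //; apply/nupper0P => // u hu.
    have u0 : u != 0.
      apply/eqP => u0; move: hu; apply/eqP.
      rewrite -(@hval_ext _ _ h (fun i => 'i%C * cvec e i)).
        by rewrite (hval_scale_eq0 hd) // -cabs_gt0 cabs_i.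
      by move=> i; rewrite u0 mul0r add0r.
    have hv : hval (fun i => ('i%C / u) * cvec e i + cvec x i) = 0.
      apply/eqP; rewrite -(hval_scale_eq0 hd _ u0); apply/eqP; rewrite -hu.
      by apply: hval_ext => i; field.
    have iu := he.2 _ _ hv; have ru := hx _ hv.
    set y := 'i%C / u in iu ru.
    have uE : u = 'i%C * y^-1 by rewrite /y invf_div mulrC divfK // -cabs_gt0 cabs_i.
    have yE : y = (complex.Re y)%:C%C by apply: complex_eqP.
    rewrite uE yE -fmorphV cImM /= mul0r add0r mul1r invr_gt0.
    by rewrite -leNgt ltW.
  by move=> /(_ x0) /(_ t ht).
have lowerb (b : R) v t : 0 < b ->
    hval (fun i => t * cvec x i + ((Complex 0 b) * cvec e i + cvec v i)) = 0 ->
    complex.Im t < 0.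
  move=> b0 ht; have bC0 : b%:C%C != 0 :> C by rewrite fmorph_eq0 gt_eqF.
  have := @lower (fun i => b^-1 * v i) (b^-1%:C%C * t).
  rewrite cImM /= mul0r addr0 pmulr_rlt0 ?invr_gt0 //; apply.
  apply/eqP; rewrite -(hval_scale_eq0 hd _ bC0); apply/eqP; rewrite -ht.
  apply: hval_ext => i; have -> : Complex 0 b = b%:C%C * 'i%C.
    by apply: complex_eqP; rewrite !(cReM, cImM) /=; ring.
  rewrite /cvec !rmorphM /= fmorphV /=; field.
  exact: bC0.
(* The limit avoids continuity of roots. Were Im t > 0, all [d] roots for parameter ib would be at
   distance at least Im t from [t], so the monic polynomial would have modulus at least (Im t)^d
   there; but its value at [t] is O(b). *)
have le0 v t : hval (fun i => t * cvec x i + cvec v i) = 0 -> complex.Im t <= 0.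
  move=> ht; rewrite leNgt; apply/negP => t0.
  pose P := npencil h (cvec x) (cvec e) (cvec v).
  have [Q [PE _ _ Pmon]] := poly_headX (fun i => npencil_size hd (cvec e) (cvec v) x0 (i := i))
    (npencil_monic hd (cvec e) (cvec v) x0).
  (* Freezing the inner variable at [t] and re-embedding the values as constants lets [pnorm_eval]
     bound Q(z)(t) uniformly in z. *)
  have [K K0 KQ] := pnorm_eval (\poly_(i < size Q) (Q`_i).[t]%:P) ler01.
  have QE z : (\poly_(i < size Q) (Q`_i).[t]%:P).[z%:P] = (Q.[z%:P].[t])%:P.
    rewrite horner_poly hornerC_sum horner_sum rmorph_sum; apply: eq_bigr => i _.
    by rewrite /= hornerZ rmorphM rmorphXn mulrC.
  have Ib (b : R) : 0 < b -> b <= 1 -> complex.Im t ^+ d <= b * K.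
    move=> b0 b1; pose z := Complex 0 b.
    have zb : cabs z = b.
      have -> : z = 'i%C * b%:C%C by apply: complex_eqP; rewrite !(cReM, cImM) /=; ring.
      by rewrite cabsM cabs_i mul1r cabs_real gtr0_norm.
    have Pt : P.[z%:P].[t] = z * Q.[z%:P].[t].
      rewrite PE hornerD hornerZ npencil_coef0 nlineE ht mulr0 add0r //.
    have Qt : cabs Q.[z%:P].[t] <= K.
      apply: le_trans (KQ z _); last by rewrite zb.
      rewrite QE; have := cabs_coef (Q.[z%:P].[t])%:P 0.
      by rewrite coefC.
    have : cabs P.[z%:P].[t] <= b * K.
      by rewrite Pt cabsM zb ler_wpM2l // ltW.
    apply: le_trans; have Pm := Pmon z; rewrite -/P in Pm.
    rewrite [P.[_]]crootsE (monicP Pm) scale1r.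
    have -> : d = size (croots P.[z%:P]).
      by rewrite size_croots ?monic_neq0 // npencilE (nline_size_monic hd _ x0).1.
    apply: cabs_prod_ge => [|y]; first exact: ltW.
    rewrite mem_croots ?monic_neq0 // npencilE root_nline // => /eqP hy.
    have y0 := lowerb b v y b0 hy.
    apply: le_trans (ler_Im_cabs _); rewrite cImD cImN.
    by apply: le_trans (ler_norm _); lra.
  have I0 : 0 < complex.Im t ^+ d by rewrite exprn_gt0.
  pose b := Num.min 1 (complex.Im t ^+ d / (2 * (K + 1))).
  have K1 : 0 < 2 * (K + 1) by lra.
  have b0 : 0 < b by rewrite lt_min ltr01 divr_gt0.
  have : b <= b by []; rewrite {2}/b le_min => /andP[b1 bK].
  have := Ib b b0 b1; rewrite ler_pdivlMr // in bK; nra.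
split=> // v z hz; apply/eqP; rewrite eq_le (le0 v z hz) /= -oppr_le0.
have := @le0 v z^*%C; have -> : complex.Im z^*%C = - complex.Im z by case: (z).
apply; rewrite -[RHS]conjc0 -hz -hval_conj; apply: hval_ext => i.
by apply: complex_eqP; rewrite !(cReD, cImD, cReM, cImM) /=; case: (z) => a b /=; ring.
Qed.

Lemma hyp_root_neq0 e t : hyp e -> hval (fun i => t * cvec e i) = 0 -> t = 0.
Proof.
move=> he /eqP ht; apply/eqP; apply: contraTT ht => t0.
by rewrite (hval_scale_eq0 hd) // he.1.
Qed.

(** A root [t] of e + av in direction [e] gives the root (t + 1)/a of [v], which is bounded by [M].
    Hence |t + 1| < 1 for small a, the root is negative, and [garding] applies. *)
Lemma hyp_perturb e v : hyp e ->
  exists2 c : R, 0 < c & forall a : R, `|a| < c -> hyp (fun i => e i + a * v i).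
Proof.
move=> he; pose M := pnorm (nline h (cvec e) (cvec v)).
have M0 : 0 <= M := pnorm_ge0 _.
exists (M + 1)^-1 => [|a a1]; first by rewrite invr_gt0 ltr_wpDl.
apply: (garding he) => t ht.
have [a0|a0] := eqVneq a 0.
  have /eqP : t + 1 = 0.
    apply: (hyp_root_neq0 he); rewrite -[RHS]ht; apply: hval_ext => i.
    by rewrite /cvec a0 mul0r addr0; ring.
  by rewrite addr_eq0 => /eqP ->; rewrite cReN /= oppr_lt0 ltr01.
have aC0 : a%:C%C != 0 :> C by rewrite fmorph_eq0.
have : cabs ((t + 1) / a%:C%C) <= M.
  apply: cabs_root_monic; first exact: (nline_size_monic hd _ he.1).2.
  rewrite root_nline ?he.1 // -(hval_scale_eq0 hd _ aC0) -ht; apply/eqP.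
  by apply: hval_ext => i; rewrite /cvec rmorphD rmorphM /=; field.
rewrite cabsM cabsV cabs_real ler_pdivrMr ?normr_gt0 // => tM.
have := le_trans (ler_Re_cabs _) tM; rewrite cReD /= => /ler_normlP[_ t1].
have : M * `|a| < 1.
  apply: le_lt_trans (_ : (M + 1) * `|a| < 1); first by rewrite ler_wpM2r // lerDl.
  by rewrite mulrC -ltr_pdivlMr ?div1r // ltr_wpDl.
by lra.
Qed.

(** If the inequality failed, a = Im s / Im t would be small enough for e + av to be hyperbolic, and
    te + sv + w would be i Im t (e + av) plus a real vector, where [h] cannot vanish. *)
Lemma root_lipschitz e v : hyp e -> exists2 c : R, 0 < c & forall w s t,
  hval (fun i => t * cvec e i + (s * cvec v i + cvec w i)) = 0 ->
  c * `|complex.Im t| <= `|complex.Im s|.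
Proof.
move=> he; have [c c0 hc] := hyp_perturb v he; exists c => // w s t ht.
rewrite leNgt; apply/negP => lt_st.
have t0 : complex.Im t != 0.
  by apply: contraTneq lt_st => ->; rewrite normr0 mulr0 -leNgt normr_ge0.
pose a := complex.Im s / complex.Im t.
have ha : hyp (fun i => e i + a * v i).
  by apply: hc; rewrite normrM normfV ltr_pdivrMr ?normr_gt0.
pose u i := complex.Re t * e i + complex.Re s * v i + w i.
have := @hyp_tube _ u (Complex 0 (complex.Im t)) ha t0; apply/negP; rewrite negbK.
apply/eqP; rewrite -[RHS]ht; apply: hval_ext => i.
have sE : complex.Im s = a * complex.Im t by rewrite divfK.
by apply: complex_eqP; rewrite !(cReD, cImD, cReM, cImM) /= /u sE; ring.
Qed.

(** For a > 0 the roots of (1 - a)e + ax in direction [e] are ar - (1 - a) with r a root of [x], so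
    they remain negative. *)
Lemma hyp_segment e x (a : R) : hyp e -> 0 <= a -> a <= 1 ->
  (forall t, hval (fun i => t * cvec e i + cvec x i) = 0 -> complex.Re t < 0) ->
  hyp (fun i => (1 - a) * e i + a * x i).
Proof.
move=> he a0 a1 hx; apply: (garding he) => t ht.
have [a00|an0] := eqVneq a 0.
  have /eqP : t + 1 = 0.
    apply: (hyp_root_neq0 he); rewrite -[RHS]ht; apply: hval_ext => i.
    by rewrite /cvec a00 mul0r addr0 subr0 mul1r mulrDl mul1r.
  by rewrite addr_eq0 => /eqP ->; rewrite cReN /= oppr_lt0 ltr01.
have aC0 : a%:C%C != 0 :> C by rewrite fmorph_eq0.
have : complex.Re (a^-1%:C%C * (t + (1 - a)%:C%C)) < 0.
  apply: hx; apply/eqP; rewrite -(hval_scale_eq0 hd _ aC0); apply/eqP.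
  rewrite -[RHS]ht; apply: hval_ext => i.
  have -> : cvec (fun i => (1 - a) * e i + a * x i) i =
      (1 - a%:C%C) * cvec e i + a%:C%C * cvec x i.
    by rewrite /cvec -!rmorphM -(rmorph1 (real_complex R)) -rmorphB -rmorphM -rmorphD.
  by rewrite fmorphV rmorphB rmorph1; field.
rewrite cReM cReD cImD /= mul0r subr0 pmulr_rlt0; first by lra.
by rewrite invr_gt0 lt_neqAle eq_sym an0.
Qed.

End Garding.

(** * Polynomial identities from values *)

Section PolynomialFacts.

Lemma poly_ext (F : numFieldType) (p q : {poly F}) : (forall t, p.[t] = q.[t]) -> p = q.
Proof.
move=> pq; apply/eqP; rewrite -subr_eq0; apply/eqP.
pose rs := [seq i%:R : F | i <- iota 0 (size (p - q)%R)].
apply: (@roots_geq_poly_eq0 _ _ rs); last by rewrite size_map size_iota.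
  by apply/allP => t _; rewrite rootE hornerD hornerN pq subrr.
by rewrite map_inj_uniq ?iota_uniq //; exact: (mulrIn (oner_neq0 F)).
Qed.

Lemma base_expansion_inj n D (a b : 'I_n -> nat) :
  (forall i, (a i < D)%N) -> (forall i, (b i < D)%N) ->
  (\sum_(i < n) a i * D ^ i = \sum_(i < n) b i * D ^ i)%N -> a =1 b.
Proof.
elim: n a b => [|n IHn] a b aD bD; first by move=> _ [].
rewrite !big_ord_recl !expn0 !muln1.
have shift (c : 'I_n.+1 -> nat) :
    (\sum_(i < n) c (lift ord0 i) * D ^ bump 0 i =
     (\sum_(i < n) c (lift ord0 i) * D ^ i) * D)%N.
  by rewrite big_distrl; apply: eq_bigr => i _; rewrite /bump add1n expnSr mulnA.
rewrite !shift => ab.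
have D0 : (0 < D)%N by rewrite (leq_ltn_trans _ (aD ord0)).
have ab0 : a ord0 = b ord0.
  have := congr1 (modn^~ D) ab; rewrite /= ![(_ + _ * D)%N]addnC !modnMDl.
  by rewrite !modn_small.
have ab' : (fun i => a (lift ord0 i)) =1 (fun i => b (lift ord0 i)).
  apply: IHn => // ; move/eqP: ab; rewrite ab0 eqn_add2l eqn_pmul2r //.
  by move/eqP.
by move=> i; case: (unliftP ord0 i) => [j|] ->; [exact: ab'|].
Qed.

(** Kronecker substitution: putting t^(D^i) for the i-th variable, with [D] above all exponents,
    sends distinct monomials to distinct powers of t and reduces the claim to one variable. *)
Lemma mpoly_eval_eq0 (F : numFieldType) n (p : {mpoly F[n]}) :
  (forall v, meval v p = 0) -> p = 0.
Proof.
move=> p0; pose D := msize p.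
pose code (m : multinom n) := (\sum_(i < n) m i * D ^ i)%N.
pose q : {poly F} := \sum_(m <- msupp p) mcoeff m p *: 'X^(code m).
have q0 : q = 0.
  apply: poly_ext => t; rewrite horner0 -(p0 (fun i => t ^+ (D ^ i))) mevalE horner_sum.
  apply: eq_bigr => m _; rewrite hornerZ hornerXn; congr (_ * _).
  by rewrite -prodrXr; apply: eq_bigr => i _; rewrite mulnC exprM.
apply/mpolyP => m; rewrite mcoeff0; apply/eqP; apply: contraT => pm.
have mp : m \in msupp p by rewrite mcoeff_msupp.
have := congr1 (fun q : {poly F} => q`_(code m)) q0; rewrite coef0 /q coef_sum.
rewrite (bigD1_seq m) //= ?msupp_uniq // coefZ coefXn eqxx mulr1 big_seq_cond big1.
  by move/eqP; rewrite addr0 (negPf pm).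
move=> m' /andP[m'p m'm]; rewrite coefZ coefXn.
suff -> : (code m == code m') = false by rewrite mulr0.
apply/negbTE; apply: contra m'm => /eqP mm'; rewrite eq_sym; apply/eqP/mnmP.
have dig m1 i : m1 \in msupp p -> (m1 i < D)%N.
  move=> m1p; apply: leq_ltn_trans (msize_mdeg_lt m1p).
  by rewrite mdegE (bigD1 i) //= leq_addr.
by apply: (@base_expansion_inj n D); [move=> i; exact: dig | move=> i; exact: dig |].
Qed.

Lemma mmap_mpolyC_id (F : comNzRingType) n (p : {mpoly F[n]}) :
  mmap (@mpolyC n F) (fun i => mpolyX F (mnm1 i)) p = p.
Proof.
rewrite [RHS](mpolyE p) /mmap; apply: eq_bigr => m _.
by rewrite mmap1_id mul_mpolyC.
Qed.

(** Both sides are the coefficient of ['X^j] in the product of the factors s X - t. *)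
Lemma coef_prod_scale (F : fieldType) (s : F) (ts : seq F) j : s != 0 ->
  s ^+ j * (\prod_(t <- ts) ('X - t%:P))`_j =
  s ^+ size ts * (\prod_(t <- [seq t / s | t <- ts]) ('X - t%:P))`_j.
Proof.
move=> s0; elim: ts j => [|t ts IHts] j; first by rewrite !big_nil !coef1; case: j => [|j]; rewrite ?mulr0.
rewrite /= !big_cons !mulrBl !coefB !coefXM !coefCM !mulrBr.
case: j => [|j] /=; rewrite ?mulr0 ?sub0r.
  rewrite !mul1r; have := IHts 0%N; rewrite expr0 mul1r => ->.
  by rewrite exprS; field.
have h1 := IHts j; have h2 := IHts j.+1.
rewrite (mulrCA _ t) h2 exprS -mulrA h1 exprS.
by field.
Qed.

End PolynomialFacts.

(** * Imaginary parts near the real axis, and second-order expansions *)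

Section ImaginaryBounds.
Variable R : realType.
Local Notation C := R[i].
Implicit Types (s t z : C).

(** Coefficients are integer polynomials in the roots, so nearly real roots give nearly real
    coefficients. The modulus bound is carried along because Im of a product needs it. *)
Lemma Im_coef_prod m (B : R) : 0 <= B -> exists2 K, 0 <= K &
  forall (r : R) (ts : seq C) j, (size ts <= m)%N -> 0 <= r ->
  (forall t, t \in ts -> cabs t <= B /\ `|complex.Im t| <= r) ->
  cabs (\prod_(t <- ts) ('X - t%:P))`_j <= K /\
  `|complex.Im (\prod_(t <- ts) ('X - t%:P))`_j| <= K * r.
Proof.
move=> B0; elim: m => [|m [K K0 IHm]].
  exists 1 => // r ts j; rewrite leqn0 size_eq0 => /eqP-> r0 _.
  rewrite big_nil coef1 mul1r.
  by case: j => [|j] /=; rewrite ?cabs1 ?cabs0 normr0.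
have BK : 0 <= B * K by rewrite mulr_ge0.
exists (1 + K + B * K + K) => [|r [|t ts] j /= sts r0 tsP]; first by lra.
  rewrite big_nil coef1; have rK : 0 <= (1 + K + B * K + K) * r by rewrite mulr_ge0 //; lra.
  by case: j => [|j] /=; rewrite ?cabs1 ?cabs0 normr0; split=> //; lra.
have bts j' : cabs (\prod_(t <- ts) ('X - t%:P))`_j' <= K /\
    `|complex.Im (\prod_(t <- ts) ('X - t%:P))`_j'| <= K * r.
  by apply: IHm => // u uts; apply: tsP; rewrite inE uts orbT.
have [tB tr] := tsP t (mem_head _ _).
rewrite big_cons mulrBl coefB coefXM coefCM.
have [cK IcK] : cabs (if j == 0%N then 0 else (\prod_(t <- ts) ('X - t%:P))`_j.-1) <= K /\
    `|complex.Im (if j == 0%N then 0 else (\prod_(t <- ts) ('X - t%:P))`_j.-1)| <= K * r.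
  case: ifP => _; last exact: bts.
  by rewrite cabs0 normr0; split=> //; apply: mulr_ge0.
have [qK IqK] := bts j; set q := _`_j in qK IqK *.
set c := (if _ then _ else _) in cK IcK *; split.
  apply: le_trans (cabsD _ _) _; rewrite cabsN cabsM.
  by have := ler_pM (cabs_ge0 _) (cabs_ge0 _) tB qK; lra.
rewrite cImD cImN; apply: le_trans (ler_normB _ _) _; rewrite cImM.
have h1 := ler_normD (complex.Re t * complex.Im q) (complex.Im t * complex.Re q).
rewrite !normrM in h1.
have h2 := ler_pM (normr_ge0 _) (normr_ge0 _) (le_trans (ler_Re_cabs _) tB) IqK.
have h3 := ler_pM (normr_ge0 _) (normr_ge0 _) tr (le_trans (ler_Re_cabs _) qK).
by rewrite !mulrDl -[B * K * r]mulrA; lra.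
Qed.

Lemma Im_horner_real (p : {poly R}) (B : R) : 0 <= B -> exists2 K, 0 <= K &
  forall s, cabs s <= B ->
  `|complex.Im (map_poly (real_complex R) p).[s]| <= K * `|complex.Im s|.
Proof.
move=> B0.
suff [K [L [K0 L0 KL]]] : exists K L : R, [/\ 0 <= K, 0 <= L & forall s, cabs s <= B ->
    cabs (map_poly (real_complex R) p).[s] <= L /\
    `|complex.Im (map_poly (real_complex R) p).[s]| <= K * `|complex.Im s|].
  by exists K => // s /KL[].
elim/poly_ind: p => [|p c [K [L [K0 L0 KL]]]].
  by exists 0, 0; split=> // s _; rewrite rmorph0 horner0 cabs0 normr0 mul0r.
exists (K * B + L), (L * B + `|c|); split=> [||s sB]; rewrite ?addr_ge0 ?mulr_ge0 //.
have [hL hK] := KL s sB; rewrite rmorphD rmorphM /= map_polyX map_polyC /=.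
rewrite hornerD hornerM hornerX hornerC; split.
  apply: le_trans (cabsD _ _) _; rewrite cabs_real cabsM lerD2r.
  by apply: ler_pM; rewrite ?cabs_ge0.
rewrite cImD /= addr0 cImM; apply: le_trans (ler_normD _ _) _; rewrite !normrM.
have h1 := ler_wpM2r (normr_ge0 (complex.Im s)) (le_trans (ler_Re_cabs _) hL).
have h2 := ler_pM (normr_ge0 _) (normr_ge0 _) hK (le_trans (ler_Re_cabs _) sB).
by rewrite mulrDl [K * B * _]mulrAC; lra.
Qed.

(** The terms of [q] beyond the second order are O(|z|^3) on the unit disc, and the estimate at z =
    0 identifies the constant term with [G s]. *)
Lemma taylor2_poly (G : C -> C) s (q : {poly C}) (K r : R) : 0 < r ->
  (forall z, cabs z < r -> cabs (G (s + z) - q.[z]) <= K * cabs z ^+ 3) ->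
  taylor2 G s.
Proof.
move=> r0 Gq; have Gs : G s = q`_0.
  have := Gq 0; rewrite cabs0 => /(_ r0); rewrite addr0 expr0n mulr0 horner_coef0.
  move=> h; apply/eqP; rewrite -subr_eq0 -cabs_eq0; apply/eqP/le_anti.
  by rewrite h cabs_ge0.
have [q1 q1E] := poly_constX q; have [q2 q2E] := poly_constX q1.
have [q3 q3E] := poly_constX q2.
exists q1`_0, q2`_0, (K + pnorm q3), (Num.min r 1).
split=> [|z]; first by rewrite lt_min r0 ltr01.
rewrite lt_min => /andP[zr z1].
have -> : G (s + z) - (G s + q1`_0 * z + q2`_0 * z ^+ 2) =
    (G (s + z) - q.[z]) + z ^+ 3 * q3.[z].
  have e1 : q.[z] = q`_0 + z * q1.[z] by rewrite {1}q1E hornerD hornerC hornerM hornerX.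
  have e2 : q1.[z] = q1`_0 + z * q2.[z] by rewrite {1}q2E hornerD hornerC hornerM hornerX.
  have e3 : q2.[z] = q2`_0 + z * q3.[z] by rewrite {1}q3E hornerD hornerC hornerM hornerX.
  by rewrite Gs e1 e2 e3; ring.
apply: le_trans (cabsD _ _) _; rewrite mulrDl; apply: lerD; first exact: Gq.
rewrite cabsM cabsX mulrC; apply: ler_wpM2r; first by rewrite exprn_ge0 ?cabs_ge0.
have := @cabs_horner _ (size q3) 1 q3 z (leqnn _) (lexx _) (ltW z1).
by rewrite expr1n mulr1.
Qed.

End ImaginaryBounds.

(** * Expansion of the upper part in powers of 1/s *)

Section HenselAtInfinity.
Variables (R : realType) (n d : nat) (h : {mpoly R[n]}).
Hypothesis hd : h \is ishomog1 d mdeg.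
Local Notation C := R[i].
Local Notation rc := (real_complex R).
Local Notation A := {mpoly R[n]}.
Local Notation MP := (@mpolyC n R).
Local Notation hval := (hval h).
Local Notation hyp := (hyp h).
Implicit Types (e v w x : 'I_n -> R) (s t z : C) (rs : seq R).

Lemma map_linep (S T : comNzRingType) (f : {rmorphism R -> S}) (g : {rmorphism R -> T})
    (phi : {rmorphism S -> T}) (X W : 'I_n -> S) : (forall a, phi (f a) = g a) ->
  map_poly phi (linep f h X W) = linep g h (phi \o X) (phi \o W).
Proof.
move=> fg; rewrite rmorph_mmap /linep /mmap; apply: eq_bigr => m _ /=.
rewrite map_polyC /= fg; congr (_ * _); apply: eq_bigr => i _ /=.
by rewrite rmorphD /= map_polyZ map_polyX map_polyC.
Qed.

Definition evalC v : A -> C := rc \o meval v.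
HB.instance Definition _ v := GRing.RMorphism.copy (evalC v) (rc \o meval v).

Definition evalCC v : {poly {poly A}} -> {poly {poly C}} := map_poly (map_poly (evalC v)).
HB.instance Definition _ v := 
  GRing.RMorphism.copy (evalCC v) (map_poly (map_poly (evalC v))).

Lemma evalCE v a : evalC v (MP a) = rc a.
Proof. by rewrite /evalC /= mevalC. Qed.

Lemma evalCX v i : evalC v (mpolyX R (mnm1 i)) = cvec v i.
Proof. by rewrite /evalC /= mevalXU. Qed.

(** Taking real parts loses nothing when [e] is hyperbolic, since all the roots are then real;
    multiplicities are kept. *)
Definition real_roots e x : seq R :=
  [seq complex.Re t | t <- croots (nline h (cvec e) (cvec x))].

Lemma mem_real_roots e x r : hyp e ->
  (r \in real_roots e x) = (hval (fun i => r%:C%C * cvec e i + cvec x i) == 0).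
Proof.
move=> he; have n0 := monic_neq0 (nline_size_monic hd (cvec x) he.1).2.
rewrite -(root_nline _ _ he.1) -mem_croots //; apply/mapP/idP => [[t tr ->]|rr].
  suff -> : (complex.Re t)%:C%C = t by [].
  rewrite mem_croots // root_nline ?he.1 // in tr; move/eqP: tr => /he.2 t0.
  by apply: complex_eqP.
by exists r%:C%C.
Qed.

Lemma nline_real_roots e x : hyp e ->
  nline h (cvec e) (cvec x) = \prod_(r <- real_roots e x) ('X - (rc r)%:P).
Proof.
move=> he; have [sn nmon] := nline_size_monic hd (cvec x) he.1.
rewrite [LHS]crootsE (monicP nmon) scale1r big_map; apply: eq_big_seq => t.
rewrite mem_croots ?monic_neq0 // root_nline ?he.1 // => /eqP /he.2 t0.
by congr ('X - _%:P); apply: complex_eqP.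
Qed.

Lemma size_real_roots e x : hyp e -> size (real_roots e x) = d.
Proof.
move=> he; have [sn nmon] := nline_size_monic hd (cvec x) he.1.
by rewrite size_map size_croots ?monic_neq0 // sn.
Qed.

Definition linepA e x : {poly A} := MP (meval e h)^-1 *: linep MP h (MP \o e) (MP \o x).

(** The splitting known over the complex numbers descends to the reals by injectivity of the
    embedding and is then pushed into the constants of the polynomial ring in [v]. *)
Lemma linepA_real_roots e x : hyp e ->
  linepA e x = \prod_(r <- real_roots e x) ('X - (MP r)%:P).
Proof.
move=> he; pose l : {poly R} := (meval e h)^-1 *: linep idfun h e x.
have lE : l = \prod_(r <- real_roots e x) ('X - r%:P).
  apply: (@map_poly_inj _ _ rc); rewrite rmorph_prod /=.
  transitivity (nline h (cvec e) (cvec x)).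
    have lc : rc (meval e h)^-1 = (hval (cvec e))^-1 by rewrite fmorphV hval_real.
    by rewrite /l map_polyZ /nline -lc; congr (_ *: _); exact: map_linep.
  rewrite nline_real_roots //; apply: eq_bigr => r _.
  by rewrite rmorphB /= map_polyX map_polyC.
transitivity (map_poly MP l).
  by rewrite /l map_polyZ; congr (_ *: _); apply/esym; exact: map_linep.
rewrite lE rmorph_prod; apply: eq_bigr => r _.
by rewrite rmorphB /= map_polyX map_polyC.
Qed.

(** The generic vector [v] is the vector of indeterminates, and the outer variable stands for 1/s,
    in view of h(te + sx + v) = s^d h((t/s)e + x + v/s). *)
Definition npencilA e x : {poly {poly A}} :=
  (MP (meval e h)^-1)%:P *:
    pencil MP h (MP \o e) (fun i => mpolyX R (mnm1 i)) (MP \o x).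

Lemma npencilA_eval e x v :
  evalCC v (npencilA e x) = npencil h (cvec e) (cvec v) (cvec x).
Proof.
rewrite /evalCC /npencilA /npencil map_polyZ /= map_polyC /= evalCE fmorphV hval_real.
congr (_ *: _); rewrite (@map_pencil _ _ _ _ MP rc); last exact: evalCE.
have E y : evalC v \o (MP \o y) = cvec y by apply/funext => i; exact: evalCE.
have EX : evalC v \o (fun i => mpolyX R (mnm1 i)) = cvec v.
  by apply/funext => i; exact: evalCX.
by rewrite !E EX.
Qed.

Definition pos_roots e x := [seq r <- real_roots e x | 0 < r].
Definition neg_roots e x := [seq r <- real_roots e x | ~~ (0 < r)].

(** The series [a] is chosen before [v], so its coefficients are polynomials in [v]; only the
    constants [L] and [K] depend on [v]. The factors at 1/s = 0 carry the positive and the negative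
    roots, and for large |s| the upper roots divided by [s] fall in the region of the positive
    ones. *)
Lemma hensel_at_infinity e x : hyp e -> hval (cvec x) != 0 ->
  let k := size (pos_roots e x) in
  exists a : {poly {poly A}}, [/\ a`_0 \is monic, size (a`_0)%R = k.+1,
    forall i, (0 < i)%N -> (size (a`_i)%R < k.+1)%N &
    forall v, exists L K : R, [/\ 0 < L, 0 <= K &
      forall s, 0 < complex.Im s -> L <= cabs s ->
      let us := upper_roots (nline h (cvec e) (fun i => s * cvec x i + cvec v i)) in
      size us = k /\
      pnorm (\prod_(t <- [seq t / s | t <- us]) ('X - t%:P) - (evalCC v a).[(s^-1)%:P])
        <= K * (cabs s)^-1 ^+ k.+1]].
Proof.
move=> he hx k; pose fs := pos_roots e x; pose gs := neg_roots e x.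
pose F (S : comNzRingType) (f : R -> S) rs : {poly S} := \prod_(r <- rs) ('X - (f r)%:P).
have F_map (S : comNzRingType) (f : R -> S) rs :
    F S f rs = \prod_(t <- map f rs) ('X - t%:P) by rewrite /F big_map.
have F_monic (S : comNzRingType) (f : R -> S) rs : F S f rs \is monic.
  by rewrite F_map monic_prod_XsubC.
have F_size (S : comNzRingType) (f : R -> S) rs : size (F S f rs) = (size rs).+1.
  by rewrite F_map size_prod_XsubC size_map.
have F_morph (S T : comNzRingType) (f : R -> S) (phi : {rmorphism S -> T}) rs :
    map_poly phi (F S f rs) = F T (phi \o f) rs.
  rewrite rmorph_prod; apply: eq_bigr => r _.
  by rewrite rmorphB /= map_polyX map_polyC.
have F_cat (S : comNzRingType) (f : R -> S) : F S f fs * F S f gs = F S f (real_roots e x).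
  by rewrite /F [RHS](bigID (fun r => 0 < r)) /= !big_filter.
have root0 r : r \in real_roots e x -> r != 0.
  rewrite mem_real_roots //; apply: contraL => /eqP ->.
  rewrite -(@hval_ext _ _ h (cvec x)) // => i; first by rewrite mul0r add0r.
have fsP r : r \in fs -> 0 < r by rewrite mem_filter => /andP[].
have gsP r : r \in gs -> r < 0.
  rewrite mem_filter -leNgt => /andP[r0 rr].
  by rewrite lt_neqAle root0.
(* Opposite signs of the roots give coprimality over the reals. *)
have [u [g bez]] : exists u g, u * F R idfun fs + g * F R idfun gs = 1.
  apply: bezout_coprime; rewrite -(coprimep_map rc) !F_morph.
  apply/Pdiv.ClosedField.coprimepP => t; rewrite !F_map !root_prod_XsubC.
  move=> tf; apply/negP => /rootP/rootP; rewrite root_prod_XsubC => tg.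
  have [r /fsP r0 tr] := mapP tf; have [r' /gsP r'0 tr'] := mapP tg.
  have /complexI rr' : rc r = rc r' by rewrite -[LHS]tr -[RHS]tr'.
  by move: r0; rewrite rr' ltNge ltW.
have bezA : map_poly MP u * F A MP fs + map_poly MP g * F A MP gs = 1.
  have := congr1 (map_poly MP) bez; rewrite rmorphD !rmorphM rmorph1 /= !F_morph.
  by [].
have PA0 : (npencilA e x)`_0 = F A MP fs * F A MP gs.
  rewrite coefZ pencil_coef0 mul_polyC F_cat; exact: linepA_real_roots.
have sfg : size (F A MP fs * F A MP gs) = d.+1.
  by rewrite F_cat F_size size_real_roots.
have sPA i : (0 < i)%N -> (size ((npencilA e x)`_i)%R < size (F A MP fs * F A MP gs)%R)%N.
  move=> i0; rewrite sfg ltnS coefZ mul_polyC.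
  have [sP _] := bidegree_le_mmap (fun a => MP a) (MP \o e) (fun i => mpolyX R (mnm1 i)) (MP \o x) hd.
  rewrite (leq_trans (size_scale_leq _ _)) // (leq_trans (sP i)) //.
  by case: i i0 => // i _; rewrite subSS leq_subr.
(* Order [k] leaves an error of order |s|^-(k+1), still O(1/s) after multiplication by powers of [s]
   up to s^k. *)
have [a [b [E [a0 b0 sa sb PE]]]] :=
  hensel_lift k (F_monic _ _ _) (F_monic _ _ _) bezA PA0 sPA.
exists a; rewrite a0 F_size F_monic; split=> // [i i0|v].
  by have := sa i i0; rewrite F_size.
have coef_eval p i : (evalCC v p)`_i = map_poly (evalC v) p`_i by rewrite coef_map.
have F_eval rs : map_poly (evalC v) (F A MP rs) = F C rc rs.
  rewrite F_morph; congr (F C _ rs); apply/funext => r; exact: evalCE.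
have [r1 r10 hr1] : exists2 r, 0 < r & forall t : C, t \in map rc fs -> r <= complex.Re t.
  by apply: seq_lower_bound => t /mapP[r /fsP r0 ->].
have [r2 r20 hr2] : exists2 r, 0 < r & forall t : C, t \in map rc gs -> r <= - complex.Re t.
  by apply: seq_lower_bound => t /mapP[r /gsP r0 ->]; rewrite oppr_gt0.
(* The regions Re t > -rho and Re t < rho overlap, which is harmless: with this [rho], a point of
   either region is at distance at least [rho] from the roots on the other side. *)
pose rho := Num.min r1 r2 / 2.
have rho0 : 0 < rho by rewrite divr_gt0 // lt_min r10.
have [rho1 rho2] : 2 * rho <= r1 /\ 2 * rho <= r2.
  rewrite /rho mulrC divfK //; split; rewrite ge_min lexx ?orbT //.
pose c := Num.min (rho ^+ size fs) (rho ^+ size gs).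
have c0 : 0 < c by rewrite lt_min !exprn_gt0.
have S2P t : complex.Re t < rho -> c <= cabs (F C rc fs).[t].
  move=> t0; rewrite F_map ge_min -(size_map rc fs); apply/orP; left.
  apply: cabs_prod_ge => [|y yf]; first exact: ltW.
  apply: le_trans (ler_Re_cabs _); rewrite cReD cReN.
  have := hr1 y yf => h1; rewrite ler_normr; apply/orP; right.
  by rewrite opprD opprK; lra.
have S1P t : - rho < complex.Re t -> c <= cabs (F C rc gs).[t].
  move=> t0; rewrite F_map ge_min -(size_map rc gs); apply/orP; right.
  apply: cabs_prod_ge => [|y yf]; first exact: ltW.
  apply: le_trans (ler_Re_cabs _); rewrite cReD cReN.
  have := hr2 y yf => h1; rewrite ler_normr; apply/orP; left.
  by lra.
have size_eval (p : {poly A}) : (size (map_poly (evalC v) p) <= size p)%N.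
  apply/leq_sizeP => j jp; rewrite coef_map nth_default //; exact: rmorph0.
have [r [K [r0 K0 stab]]] : exists r K : R, [/\ 0 < r, 0 <= K & forall z fs' gs', cabs z < r ->
    (npencil h (cvec e) (cvec v) (cvec x)).[z%:P] =
      \prod_(t <- fs') ('X - t%:P) * \prod_(t <- gs') ('X - t%:P) ->
    (forall t, t \in fs' -> - rho < complex.Re t) ->
    (forall t, t \in gs' -> complex.Re t < rho) ->
    size fs' = k /\
    pnorm (\prod_(t <- fs') ('X - t%:P) - (evalCC v a).[z%:P]) <= K * cabs z ^+ k.+1].
  have := @hensel_stability R (F C rc fs) (F C rc gs) (npencil h (cvec e) (cvec v) (cvec x))
    (evalCC v a) (evalCC v b) (evalCC v E) k c
    (fun t => - rho < complex.Re t) (fun t => complex.Re t < rho).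
  rewrite !F_size; apply=> //.
  - exact: F_monic.
  - exact: F_monic.
  - by rewrite coef_eval a0 F_eval.
  - by rewrite coef_eval b0 F_eval.
  - move=> i i0; rewrite coef_eval (leq_ltn_trans (size_eval _)) //.
    by have := sa i i0; rewrite F_size.
  - move=> i i0; rewrite coef_eval (leq_ltn_trans (size_eval _)) //.
    by have := sb i i0; rewrite F_size.
  - by rewrite -npencilA_eval coef_eval PA0 rmorphM /= !F_eval.
  - move=> i i0; rewrite F_cat F_size size_real_roots //.
    have := npencil_size hd (cvec v) (cvec x) he.1 i0.
    by rewrite npencil_coef0 (nline_size_monic hd _ he.1).1.
  - by rewrite -npencilA_eval PE rmorphD !rmorphM rmorphXn /= /evalCC map_polyX.
have [c' c'0 lip] := root_lipschitz hd v he.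
(* The first bound puts 1/s in the disc of radius [r]; the second gives 1/(c'|s|) < rho, which
   locates the roots t/s. *)
pose L := Num.max (2 / r) (2 / (c' * rho)).
have L0 : 0 < L by rewrite lt_max divr_gt0.
exists L, K; split=> // s s0 Ls us.
pose P := nline h (cvec e) (fun i => s * cvec x i + cvec v i).
have Pmon : P \is monic := (nline_size_monic hd _ he.1).2.
have sn0 : s != 0 by rewrite -cabs_gt0 (lt_le_trans L0).
have cs0 : 0 < cabs s by rewrite cabs_gt0.
have Lr : cabs s^-1 < r.
  rewrite cabsV invf_plt ?posrE //; apply: lt_le_trans Ls.
  rewrite lt_max; apply/orP; left; rewrite -[ltLHS]mul1r ltr_pM2r ?invr_gt0 //.
  by rewrite ltr1n.
have Lrho : (c' * cabs s)^-1 < rho.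
  have : 2 / (c' * rho) <= cabs s by apply: le_trans Ls; rewrite le_max lexx orbT.
  rewrite ler_pdivrMr; last exact: mulr_gt0.
  move=> h2; rewrite -[ltLHS]mul1r ltr_pdivrMr; last exact: mulr_gt0.
  by clear -h2; lra.
have PcE : (npencil h (cvec e) (cvec v) (cvec x)).[(s^-1)%:P] =
    \prod_(t <- [seq t / s | t <- us]) ('X - t%:P) *
    \prod_(t <- [seq t / s | t <- lower_roots P]) ('X - t%:P).
  rewrite npencilE -big_cat /= -map_cat; apply: poly_ext => y.
  have Py : P.[s * y] = s ^+ d * (nline h (cvec e) (fun i => s^-1 * cvec v i + cvec x i)).[y].
    rewrite !nlineE mulrCA -(hval_scale hd); congr (_ * _); apply: hval_ext => i.
    by field.
  apply: (mulfI (expf_neq0 d sn0)); rewrite -Py {1}[P]upper_partM (monicP Pmon) scale1r.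
  rewrite /upper_part /lower_part -big_cat /= big_map.
  have -> : d = size (us ++ lower_roots P).
    have := (nline_size_monic hd (fun i => s * cvec x i + cvec v i) he.1).1.
    rewrite -/P {1}[P]upper_partM (monicP Pmon) scale1r size_monicM ?upper_part_monic //; last first.
      exact/monic_neq0/lower_part_monic.
    by rewrite size_upper_part size_lower_part size_cat addnS /= addSn => -[].
  elim: (us ++ lower_roots P) => [|t ts IHts]; first by rewrite !big_nil !hornerC mulr1.
  rewrite /= !big_cons !hornerM IHts !hornerXsubC exprS.
  by field.
(* t/s is a root of h(ye + v/s + x) in y, so [root_lipschitz] with parameter 1/s applies, where
   |Im(1/s)| = Im s / |s|^2. *)
have tRe t : root P t -> `|complex.Im (t / s)| <= complex.Im s / (c' * cabs s ^+ 2).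
  rewrite root_nline ?he.1 // => /eqP ht.
  have := lip x s^-1 (t / s); rewrite (_ : hval _ = 0); last first.
    have si0 : s^-1 != 0 by rewrite invr_eq0.
    apply/eqP; rewrite -(hval_scale_eq0 hd _ sn0) -[X in _ == X]ht; apply/eqP.
    by apply: hval_ext => i; field.
  have -> : `|complex.Im s^-1| = complex.Im s / cabs s ^+ 2.
    have sE : s^-1 = s^*%C * ((cabs s ^+ 2)^-1)%:C%C.
      rewrite invc_norm mulrC; congr (_ * _); rewrite fmorphV rmorphXn /= -cabsE.
      by [].
    rewrite sE cImM /= mulr0 add0r normrM; have -> : complex.Im s^*%C = - complex.Im s by case: (s).
    rewrite normrN (gtr0_norm s0) ger0_norm // invr_ge0.
    by rewrite exprn_ge0 // ltW.
  move=> /(_ erefl); rewrite -(ler_pdivlMl _ _ c'0) => /le_trans; apply.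
  by rewrite (invfM c') mulrCA.
(* The first summand will be smaller than rho Im s, so the sign of Im t confines Re(t/s) to the
   right side of -rho or of rho. *)
have ReIm t : complex.Im t = complex.Re s * complex.Im (t / s) + complex.Im s * complex.Re (t / s).
  by rewrite -cImM mulrC divfK.
have bnd t : root P t -> `|complex.Re s * complex.Im (t / s)| < complex.Im s * rho.
  move=> /tRe h1; rewrite normrM.
  apply: le_lt_trans (_ : cabs s * (complex.Im s / (c' * cabs s ^+ 2)) < _).
    by apply: ler_pM; rewrite ?ler_Re_cabs.
  have -> : cabs s * (complex.Im s / (c' * cabs s ^+ 2)) = complex.Im s * (c' * cabs s)^-1.
    by field; rewrite !gt_eqF.
  by rewrite ltr_pM2l.
have Pn0 := monic_neq0 Pmon.
have [] := stab s^-1 [seq t / s | t <- us] [seq t / s | t <- lower_roots P] Lr PcE.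
- move=> _ /mapP[t tu ->]; move: tu; rewrite mem_upper_roots // => /andP[tr t0].
  have := bnd t tr; rewrite ltr_norml => /andP[_ h2]; rewrite ReIm in t0.
  rewrite -(ltr_pM2l s0) mulrN; lra.
- move=> _ /mapP[t tu ->]; move: tu; rewrite mem_lower_roots // -leNgt => /andP[tr t0].
  have := bnd t tr; rewrite ltr_norml => /andP[h2 _]; rewrite ReIm in t0.
  rewrite -(ltr_pM2l s0); lra.
by rewrite size_map cabsV.
Qed.

End HenselAtInfinity.

(** * Roots of both signs force a polynomial factorization *)

Section MixedSigns.
Variables (R : realType) (n d : nat) (h : {mpoly R[n]}).
Hypothesis hd : h \is ishomog1 d mdeg.
Local Notation C := R[i].
Local Notation rc := (real_complex R).
Local Notation A := {mpoly R[n]}.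
Local Notation MP := (@mpolyC n R).
Local Notation hval := (hval h).
Local Notation hyp := (hyp h).
Local Notation nline := (nline h).
Local Notation evalC := (@evalC R n).
Local Notation evalCC := (@evalCC R n).
Implicit Types (e v w x : 'I_n -> R) (s t z : C).

(** The indeterminates become [v] and the inner variable becomes [s]; the outer variable, which is
    kept, is t. *)
Definition evalAt v s : {poly {poly A}} -> {poly C} :=
  map_poly (horner_eval s \o map_poly (evalC v)).
HB.instance Definition _ v s :=
  GRing.RMorphism.copy (evalAt v s) (map_poly (horner_eval s \o map_poly (evalC v))).

Lemma coef_evalAt v s (p : {poly {poly A}}) j :
  (evalAt v s p)`_j = (map_poly (evalC v) p`_j).[s].
Proof. by rewrite coef_map. Qed.

Lemma coef_hornerC (Q : {poly {poly C}}) z j :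
  (Q.[z%:P])`_j = (\poly_(i < size Q) (Q`_i)`_j).[z].
Proof.
rewrite hornerC_sum coef_sum horner_poly; apply: eq_bigr => i _.
by rewrite coefZ mulrC.
Qed.

(* [a] lists the coefficients of s^-i in a factor of h(t e + x + v / s), monic of
   degree [k] in t; this is the polynomial part of s^k times that factor at t / s. *)
Definition rescale_trunc k (a : {poly {poly A}}) : {poly {poly A}} :=
  \poly_(j < k.+1) \poly_(l < (k - j).+1) (a`_(k - j - l))`_j.

Lemma rescale_truncE v s k a j : s != 0 -> (j <= k)%N ->
  (evalAt v s (rescale_trunc k a))`_j =
  s ^+ (k - j) *
    (take_poly (k - j).+1 (\poly_(i < size (evalCC v a)) ((evalCC v a)`_i)`_j)).[s^-1].
Proof.
move=> s0 jk; rewrite coef_evalAt coef_poly ltnS jk; set m := (k - j)%N.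
have cE i : (\poly_(i < size (evalCC v a)) ((evalCC v a)`_i)`_j)`_i = evalC v (a`_i)`_j.
  have E : ((evalCC v a)`_i)`_j = evalC v (a`_i)`_j by rewrite /evalCC coef_map /= coef_map.
  rewrite -E coef_poly; case: ltnP => // ai.
  by rewrite [(evalCC v a)`_i]nth_default // coef0.
rewrite [LHS](_ : _ = (\poly_(l < m.+1) evalC v (a`_(m - l))`_j).[s]); last first.
  congr (_.[s]); apply/polyP => l; rewrite coef_map !coef_poly.
  by case: ifP => _ //; exact: rmorph0.
rewrite horner_poly /take_poly horner_poly mulr_sumr (reindex_inj rev_ord_inj) /=.
apply: eq_bigr => i _; have im : (i <= m)%N := ltn_ord i.
rewrite cE subSS (subKn im) mulrCA; congr (_ * _).
move: (nat_of_ord i) im => l lm.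
by rewrite -{2}(subnK lm) exprD exprVn mulfK // expf_neq0.
Qed.

(** * The upper part as a polynomial in s, for a fixed v *)

Section Dichotomy.
Variables (e x : 'I_n -> R) (k : nat) (a : {poly {poly A}}) (v : 'I_n -> R).
Hypotheses (he : hyp e) (hx : hyp x).
Variables (L K : R).
Hypothesis K0 : 0 <= K.
Local Notation pl s := (nline (cvec e) (fun i => s * cvec x i + cvec v i)).
Hypothesis inf : forall s, 0 < complex.Im s -> L <= cabs s ->
  let us := upper_roots (pl s) in
  size us = k /\
  pnorm (\prod_(t <- [seq t / s | t <- us]) ('X - t%:P) - (evalCC v a).[(s^-1)%:P])
    <= K * (cabs s)^-1 ^+ k.+1.

Lemma pl_nonreal s t : 0 < complex.Im s ->
  hval (fun i => t * cvec e i + (s * cvec x i + cvec v i)) = 0 -> complex.Im t != 0.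
Proof. by move=> s0; apply: (hyp_nonreal hx); rewrite gt_eqF. Qed.

Lemma cabs_Im_lt s z : 0 < complex.Im s -> cabs z < complex.Im s ->
  0 < complex.Im (s + z).
Proof.
move=> s0 zs; rewrite cImD; have := ler_Im_cabs z; rewrite ler_norml => /andP[h1 _].
by lra.
Qed.

Lemma pl_upper_local s : 0 < complex.Im s ->
  exists (b : {poly {poly C}}) (r M : R), [/\ 0 < r, 0 <= M & forall z, cabs z < r ->
    [/\ 0 < complex.Im (s + z),
      size (upper_part (pl (s + z))) = size (upper_part (pl s)) &
      pnorm (upper_part (pl (s + z)) - b.[z%:P]) <= M * cabs z ^+ 3]].
Proof.
move=> s0; have [b [r [M [r0 M0 loc]]]] := nupper_local hd he.1 (fun t => @pl_nonreal s t s0).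
exists b, (Num.min r (complex.Im s)), M; split; [by rewrite lt_min r0 | exact: M0 | move=> z].
rewrite lt_min => /andP[zr zs]; have sz := cabs_Im_lt s0 zs.
by have [] := loc z zr (fun t => @pl_nonreal (s + z) t sz).
Qed.

(** The number of upper roots is locally constant, hence constant along the vertical ray from [s],
    which reaches |s| >= L where [inf] gives the count. *)
Lemma size_pl_upper s : 0 < complex.Im s -> size (upper_roots (pl s)) = k.
Proof.
move=> s0; pose f (y : R) := size (upper_part (pl (s + Complex 0 `|y|))).
have sy (y : R) : 0 < complex.Im (s + Complex 0 `|y|) by rewrite cImD /= ltr_wpDr.
have fcst : f 0 = f L.
  apply: locally_const_nat => y; have [b [r [M [r0 _ loc]]]] := pl_upper_local (sy y).
  exists r; first exact: r0.
  move=> u ur; pose z : C := Complex 0 (`|y + u| - `|y|).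
  have zE : s + Complex 0 `|y + u| = s + Complex 0 `|y| + z.
    by apply: complex_eqP; rewrite !(cReD, cImD) /=; ring.
  have zr : cabs z < r.
    apply: le_lt_trans ur; apply: le_trans (cabs_le_ReIm _) _; rewrite /= normr0 add0r.
    by have := ler_dist_dist (y + u) y; rewrite addrAC subrr add0r.
  by rewrite /f zE; have [] := loc z zr.
apply: succn_inj; rewrite -size_upper_part.
have -> : size (upper_part (pl s)) = f 0.
  have s0E : s + Complex 0 0 = s by apply: complex_eqP; rewrite !(cReD, cImD) /= addr0.
  by rewrite /f normr0 s0E; reflexivity.
rewrite fcst /f size_upper_part; congr S.
have [] := inf (sy L); last by [].
apply: le_trans (ler_Im_cabs _); rewrite cImD /= ger0_norm; last by rewrite addr_ge0 // ltW.
by rewrite (le_trans (ler_norm L)) // lerDr ltW.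
Qed.

Lemma upper_part_coef_eq s j : 0 < complex.Im s -> (j <= k)%N ->
  (upper_part (pl s))`_j = (evalAt v s (rescale_trunc k a))`_j.
Proof.
move=> s0 jk; apply/eqP; rewrite -subr_eq0; apply/eqP.
(* That [cj] has real coefficients is essential: its imaginary part vanishes at the real axis, so
   subtracting it keeps the boundary condition. *)
pose cj : {poly R} := map_poly (meval v) (rescale_trunc k a)`_j.
have cjE z : (evalAt v z (rescale_trunc k a))`_j = (map_poly rc cj).[z].
  by rewrite coef_evalAt /cj -map_poly_comp.
pose G z := (upper_part (pl z))`_j - (map_poly rc cj).[z].
rewrite cjE -/(G s); move: s s0; apply: half_plane_eq0 => [s s0|M eps eps0|eps eps0].
- have [b [r [M [r0 M0 loc]]]] := pl_upper_local s0.
  apply: (@taylor2_poly R G s (\poly_(i < size b) (b`_i)`_j -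
    (map_poly rc cj \Po ('X + s%:P))) M r) => // z zr.
  have [_ _ nz] := loc z zr; apply: le_trans nz.
  rewrite /G hornerD hornerN horner_comp hornerD hornerX hornerC [z + s]addrC.
  by rewrite -coef_hornerC opprB addrA subrK -coefB cabs_coef.
(* At the real axis: for |s| <= B the roots are bounded by [KP], and their imaginary parts by Im s /
   c, so both terms of [G] have imaginary part O(Im s). *)
- pose B := `|M| + 1; have B0 : 0 <= B by rewrite addr_ge0.
  have [KP KP0 nP] := pnorm_eval (npencil h (cvec e) (cvec x) (cvec v)) B0.
  have [c c0 lip] := root_lipschitz hd x he.
  have [K1 K10 HK1] := Im_coef_prod k KP0.
  have [K2 K20 HK2] := Im_horner_real cj B0.
  pose D := K1 / c + K2 + 1.
  have D0 : 0 < D by rewrite ltr_wpDl // addr_ge0 // mulr_ge0 // invr_ge0 ltW.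
  exists (Num.min 1 (eps / D)) => [|s s0]; first by rewrite lt_min ltr01 divr_gt0.
  rewrite lt_min => /andP[s1 sD] sM.
  have sB : cabs s <= B.
    apply: le_trans (cabs_le_ReIm _) _; apply: lerD.
      by apply: le_trans sM (ler_norm _).
    by rewrite gtr0_norm // ltW.
  have [smon1 smon2] := nline_size_monic hd (fun i => s * cvec x i + cvec v i) he.1.
  have pn0 := monic_neq0 smon2.
  have [] := HK1 (complex.Im s / c) (upper_roots (pl s)) j.
  + by rewrite size_pl_upper.
  + by rewrite divr_ge0 // ltW.
  + move=> t; rewrite mem_upper_roots // => /andP[tr _]; split.
      apply: le_trans (nP s sB); rewrite npencilE.
      exact: cabs_root_monic.
    rewrite ler_pdivlMr // mulrC -[X in _ <= X](gtr0_norm s0).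
    by apply: (lip v); apply/eqP; rewrite -root_nline ?he.1.
  move=> _ h1; have := HK2 s sB; rewrite (gtr0_norm s0) => h2.
  rewrite /G cImD cImN; apply: le_trans (ler_normB _ _) _.
  apply: le_trans (lerD h1 h2) _.
  have -> : K1 * (complex.Im s / c) + K2 * complex.Im s = (K1 / c + K2) * complex.Im s.
    by field; rewrite gt_eqF.
  apply: le_trans (_ : D * complex.Im s <= _).
    by rewrite ler_wpM2r ?(ltW s0) // /D lerDl.
  by rewrite mulrC -ler_pdivlMr // ltW.
(* At infinity: up to the Hensel error, [q] at 1/s is the j-th coefficient of the rescaled factor.
   Truncation drops only powers of 1/s above [m]; times s^m, both this tail and the error are
   O(1/s). *)
pose q : {poly C} := \poly_(i < size (evalCC v a)) ((evalCC v a)`_i)`_j.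
pose m := (k - j)%N; pose K3 := pnorm (drop_poly m.+1 q).
have K30 : 0 <= K3 := pnorm_ge0 _.
exists (Num.max L (Num.max 1 ((K + K3) / eps))) => s s0.
rewrite !ge_max => /and3P[Ls s1 sK].
have cs0 : 0 < cabs s by apply: lt_le_trans s1.
have sn0 : s != 0 by rewrite -cabs_gt0.
have [sus ninf] := inf s0 Ls.
have fE : (upper_part (pl s))`_j =
    s ^+ m * (\prod_(t <- [seq t / s | t <- upper_roots (pl s)]) ('X - t%:P))`_j.
  apply: (mulfI (expf_neq0 j sn0)); rewrite coef_prod_scale // sus mulrA -exprD.
  by rewrite subnKC.
have pE : (map_poly rc cj).[s] = s ^+ m * (take_poly m.+1 q).[s^-1].
  by rewrite -cjE rescale_truncE.
have qE : q.[s^-1] = (take_poly m.+1 q).[s^-1] + (drop_poly m.+1 q).[s^-1] * s^-1 ^+ m.+1.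
  by rewrite -{1}(poly_take_drop m.+1 q) hornerD hornerM hornerXn.
have iv1 : cabs s^-1 <= 1 by rewrite cabsV invf_le1.
rewrite /G fE pE -mulrBr cabsM cabsX.
set F := \prod_(t <- _) _ in ninf *.
have Fq : cabs (F`_j - q.[s^-1]) <= K * (cabs s)^-1 ^+ k.+1.
  by apply: le_trans ninf; rewrite -coef_hornerC -coefB cabs_coef.
have Dq : cabs ((drop_poly m.+1 q).[s^-1] * s^-1 ^+ m.+1) <= K3 * (cabs s)^-1 ^+ m.+1.
  rewrite cabsM cabsX cabsV ler_wpM2r ?exprn_ge0 ?invr_ge0 ?cabs_ge0 //.
  have := @cabs_horner _ (size (drop_poly m.+1 q)) 1 (drop_poly m.+1 q) s^-1.
  by rewrite expr1n mulr1; apply.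
have i1 : (cabs s)^-1 <= 1 by rewrite invf_le1.
have i0 : 0 <= (cabs s)^-1 by rewrite invr_ge0 ltW.
have total : cabs (F`_j - (take_poly m.+1 q).[s^-1]) <= (K + K3) * (cabs s)^-1 ^+ m.+1.
  have -> : F`_j - (take_poly m.+1 q).[s^-1] =
      (F`_j - q.[s^-1]) + (drop_poly m.+1 q).[s^-1] * s^-1 ^+ m.+1 by rewrite qE; ring.
  apply: le_trans (cabsD _ _) _; rewrite mulrDl; apply: lerD Dq.
  apply: le_trans Fq _; apply: ler_wpM2l => //.
  by apply: ler_wiXn2l => //; rewrite ltnS leq_subr.
apply: le_trans (ler_wpM2l (exprn_ge0 _ (ltW cs0)) total) _.
have -> : cabs s ^+ m * ((K + K3) * (cabs s)^-1 ^+ m.+1) = (K + K3) * (cabs s)^-1.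
  rewrite mulrCA; congr (_ * _).
  by rewrite exprSr mulrA -exprMn divff ?gt_eqF // expr1n mul1r.
by rewrite ler_pdivrMr // mulrC -ler_pdivrMr.
Qed.

Lemma upper_part_evalAt s : 0 < complex.Im s ->
  evalAt v s (rescale_trunc k a) = upper_part (pl s).
Proof.
move=> s0; apply/polyP => j; have [jk|kj] := leqP j k.
  by rewrite -upper_part_coef_eq.
rewrite [RHS]nth_default; last by rewrite size_upper_part size_pl_upper.
by rewrite coef_evalAt coef_poly ltnS leqNgt kj /= rmorph0 horner0.
Qed.

End Dichotomy.

(** The truncated expansion [p] is monic in t, so division by it is possible over the polynomials in
    [v] and s. The remainder vanishes since [p] specializes to an actual divisor at each real [v]
    and each s in the upper half-plane. Vanishing of both factors at the origin makes them
    non-units. *)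
Lemma mixed_roots_factor e x r1 r2 : hyp e -> hyp x ->
  r1 \in real_roots h e x -> 0 < r1 -> r2 \in real_roots h e x -> r2 < 0 ->
  exists f g : A, [/\ h = f * g, meval (fun=> 0) f = 0 & meval (fun=> 0) g = 0].
Proof.
move=> he hx r1P r10 r2P r20.
have [a [a0mon sa0 sa inf]] := hensel_at_infinity hd he hx.1.
set k := size (pos_roots h e x) in sa0 sa inf.
(* [r1] and [r2] give 0 < k < d, so both factors have positive degree in t. *)
have k0 : (0 < k)%N.
  by rewrite /k size_filter -has_count; apply/hasP; exists r1.
have kd : (k < d)%N.
  rewrite -(size_real_roots hd x he) /k size_filter.
  rewrite -(count_predC (fun r => 0 < r)) -[ltnLHS]addn0 ltn_add2l -has_count.
  by apply/hasP; exists r2 => //=; rewrite -leNgt ltW.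
pose p := rescale_trunc k a.
pose P : {poly {poly A}} := (MP (meval e h)^-1)%:P%:P *
  pencil MP h (MP \o x) (MP \o e) (fun i => mpolyX R (mnm1 i)).
have P_evalAt v s : evalAt v s P = nline (cvec e) (fun i => s * cvec x i + cvec v i).
  have evalAtE (q : {poly {poly A}}) : evalAt v s q = map_poly (horner_eval s) (evalCC v q).
    by rewrite /evalAt /evalCC map_poly_comp.
  have E y : evalC v \o (MP \o y) = cvec y by apply/funext => i; exact: evalCE.
  have EX : evalC v \o (fun i => mpolyX R (mnm1 i)) = cvec v.
    by apply/funext => i; exact: evalCX.
  rewrite /P rmorphM; apply: poly_ext => t; rewrite hornerM nlineE; congr (_ * _).
    rewrite /= /evalAt map_polyC hornerC /= map_polyC /horner_eval hornerC /= evalCE.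
    by rewrite fmorphV hval_real.
  rewrite /= evalAtE /evalCC (@map_pencil _ _ _ _ MP rc); last exact: evalCE.
  have ev (Q : {poly {poly C}}) : (map_poly (horner_eval s) Q).[t] = (Q.[t%:P]).[s].
    by rewrite -{1}(hornerC t s) -/(horner_eval s t%:P) horner_map.
  rewrite !E EX ev pencilE linepE; apply: eq_bigr => m _; congr (_ * _).
  by apply: eq_bigr => i _; congr (_ ^+ _); ring.
have p_coef j : (k < j)%N -> p`_j = 0 by move=> kj; rewrite coef_poly ltnS leqNgt kj.
have pk : p`_k = 1.
  rewrite coef_poly ltnSn subnn; apply/polyP => l; rewrite coef_poly coef1.
  case: l => [|l] //=; move/monicP: a0mon; rewrite lead_coefE sa0 /=.
  by [].
have sp : size p = k.+1.
  apply/eqP; rewrite eqn_leq; apply/andP; split; first exact/leq_sizeP/p_coef.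
  rewrite ltnNge; apply/negP => /leq_sizeP/(_ k (leqnn k))/eqP.
  by rewrite pk oner_eq0.
have pmon : p \is monic by rewrite monicE lead_coefE sp /= pk.
pose q := Pdiv.Ring.rdivp P p; pose r := Pdiv.Ring.rmodp P p.
have PE : P = q * p + r by exact: Pdiv.RingMonic.rdivp_eq.
have sr : (size r < k.+1)%N by rewrite -sp Pdiv.Ring.ltn_rmodpN0 ?monic_neq0.
(* After specialization the upper part, of degree [k], divides the remainder, of degree below
   [k]. *)
have r_evalAt v s : 0 < complex.Im s -> evalAt v s r = 0.
  move=> s0; have [L [K [L0 K0 infv]]] := inf v.
  have fE : evalAt v s p = _ := upper_part_evalAt he hx K0 infv s0.
  have sk := size_pl_upper he hx infv s0.
  have := P_evalAt v s; rewrite PE rmorphD rmorphM /= fE.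
  set f := nline _ _; rewrite [in RHS](upper_partM f).
  rewrite (monicP (nline_size_monic hd _ he.1).2) scale1r => rE.
  apply/eqP; apply/negPn/negP => r0.
  have : evalAt v s r = (lower_part f - evalAt v s q) * upper_part f.
    by rewrite -[LHS](addKr (evalAt v s q * upper_part f)) rE; ring.
  move=> rE'; have q0 : lower_part f - evalAt v s q != 0.
    by apply: contraNneq r0 => q0; rewrite rE' q0 mul0r.
  have := size_Mmonic q0 (upper_part_monic f); rewrite -rE' size_upper_part sk.
  rewrite addnS /= => sE; have : (size (evalAt v s r) <= k)%N.
    rewrite (leq_trans _ (sr : (size r <= k)%N)) //.
    by apply/leq_sizeP => j jr; rewrite coef_evalAt nth_default // rmorph0 horner0.
  by rewrite sE -[X in (_ <= X)%N]add0n leq_add2r leqn0 size_poly_eq0 (negPf q0).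
have r0 : r = 0.
  apply/polyP => j; rewrite coef0; apply/polyP => l; rewrite coef0.
  apply: mpoly_eval_eq0 => v; apply: (@complexI R).
  (* A polynomial in s vanishing on the whole upper half-plane vanishes at i, 2i, 3i and so on, more
     points than its degree allows. *)
  have pj0 : map_poly (evalC v) r`_j = 0.
    pose F := map_poly (evalC v) r`_j; apply: (@roots_geq_poly_eq0 _ _
      [seq Complex 0 (i.+1%:R : R) | i <- iota 0 (size F)]).
    - apply/allP => _ /mapP[i _ ->]; rewrite rootE -coef_evalAt r_evalAt ?coef0 //=.
    - rewrite map_inj_uniq ?iota_uniq // => i i' [] /eqP.
      by rewrite eqr_nat eqSS => /eqP.
    - by rewrite size_map size_iota.
  have := congr1 (fun F : {poly C} => F`_l) pj0; rewrite coef0 coef_map /=.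
  by [].
rewrite r0 addr0 in PE.
have P00 : (P.[0]).[0] = MP (meval e h)^-1 * h.
  rewrite /P hornerM hornerC hornerM hornerC; congr (_ * _).
  rewrite -[X in (pencil _ _ _ _ _).[X]]polyC0 pencilE linepE -[RHS]mmap_mpolyC_id.
  by apply: eq_bigr => m _; congr (_ * _); apply: eq_bigr => i _; rewrite !mul0r !add0r.
have hE : h = (MP (meval e h) * (q.[0]).[0]) * (p.[0]).[0].
  rewrite -mulrA -!hornerM -PE P00 mulrA -mpolyCM mulfV ?mul1r //.
  by have := he.1; rewrite hval_real fmorph_eq0.
have eval00 (F : {poly {poly A}}) : (evalAt (fun=> 0) 0 F).[0] =
    rc (meval (fun=> 0) (F.[0]).[0]).
  by rewrite !horner_coef0 coef_evalAt horner_coef0; exact: coef_map.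
(* At v = 0 and s = 0 the pencil is t^d, so a nonconstant factor of it must vanish at t = 0. *)
have Xd : 'X^d = evalAt (fun=> 0) 0 q * evalAt (fun=> 0) 0 p :> {poly C}.
  rewrite -rmorphM -PE /= P_evalAt; apply: poly_ext => t; rewrite hornerXn nlineE.
  have -> : hval (fun i => t * cvec e i + (0 * cvec x i + cvec (fun=> 0) i)) =
      t ^+ d * hval (cvec e).
    by rewrite -(hval_scale hd); apply: hval_ext => i; rewrite mul0r add0r addr0.
  by rewrite mulrCA mulVf ?he.1 // mulr1.
set p1 := evalAt _ _ p in Xd; set q1 := evalAt _ _ q in Xd.
have p1mon : p1 \is monic.
  exact: monic_map.
have sp1 : size p1 = k.+1.
  by rewrite -sp; apply: size_map_poly_id0; rewrite (monicP pmon) rmorph1 oner_eq0.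
have q10 : q1 != 0.
  by apply: contra_eq_neq Xd => ->; rewrite mul0r monic_neq0 ?monicXn.
have sq1 : (1 < size q1)%N.
  have := congr1 (fun F : {poly C} => size F) Xd; rewrite size_polyXn size_Mmonic // sp1 addnS /=.
  move=> sE; rewrite -(ltn_add2r k) -sE add1n.
  by rewrite ltnS.
have root0 (F : {poly C}) : F %| 'X^d -> (1 < size F)%N -> F.[0] = 0.
  move=> Fd sF; apply/eqP; apply/negPn/negP => F0.
  have : coprimep F 'X^d.
    by rewrite coprimep_expr // -['X]subr0 coprimep_XsubC // rootE.
  by rewrite /coprimep (eqp_size (dvdp_gcd_idl Fd)) => /eqP F1; rewrite F1 in sF.
have z0 (F : {poly {poly A}}) : (evalAt (fun=> 0) 0 F).[0] = 0 ->
    meval (fun=> 0) (F.[0]).[0] = 0.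
  by rewrite eval00 => /complexI.
exists (MP (meval e h) * (q.[0]).[0]), (p.[0]).[0]; split; first exact: hE.
  by rewrite mevalM z0 ?mulr0 // root0 // Xd dvdp_mulr.
by apply: z0; rewrite root0 ?sp1 // Xd dvdp_mull.
Qed.

End MixedSigns.

(** * The two components of the hyperbolicity set *)

Section Components.
Variables (R : realType) (n d : nat) (h : {mpoly R[n]}).
Hypothesis hd : h \is ishomog1 d mdeg.
Local Notation C := R[i].
Local Notation hval := (hval h).
Local Notation hyp := (hyp h).
Implicit Types (e v w x : 'I_n -> R).

Lemma real_roots_lt0 e x : hyp e -> (forall r, r \in real_roots h e x -> r < 0) ->
  forall t, hval (fun i => t * cvec e i + cvec x i) = 0 -> complex.Re t < 0.
Proof.
move=> he rneg t ht; apply: rneg; rewrite (mem_real_roots hd) //; apply/eqP.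
have t0 := he.2 _ _ ht; suff -> : (complex.Re t)%:C%C = t by [].
by apply: complex_eqP.
Qed.

Lemma hypN e : hyp e -> hyp (fun i => - e i).
Proof.
move=> [e0 he]; have NE i : cvec (fun i => - e i) i = - cvec e i by rewrite /cvec rmorphN.
split.
  rewrite (@hval_ext _ _ h _ (fun i => -1 * cvec e i)); last by move=> i; rewrite mulN1r.
  by rewrite (hval_scale_eq0 hd) // oppr_eq0 oner_eq0.
move=> v z hz; apply/eqP; rewrite -oppr_eq0 -cImN; apply/eqP/(he v).
by rewrite -[RHS]hz; apply: hval_ext => i; rewrite NE mulNr mulrN.
Qed.

Lemma real_rootsN e x r : hyp e ->
  (r \in real_roots h (fun i => - e i) x) = (- r \in real_roots h e x).
Proof.
move=> he; rewrite (mem_real_roots hd _ _ (hypN he)) (mem_real_roots hd _ _ he).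
rewrite (@hval_ext _ _ h _ (fun i => (- r)%:C%C * cvec e i + cvec x i)) // => i.
by rewrite /cvec !rmorphN mulrN mulNr.
Qed.

Lemma real_roots_self e r : hyp e -> (r \in real_roots h e e) -> r = -1.
Proof.
move=> he; rewrite (mem_real_roots hd) // => /eqP hr.
have /(hyp_root_neq0 hd he) : hval (fun i => (r + 1)%:C%C * cvec e i) = 0.
  by rewrite -[RHS]hr; apply: hval_ext => i; rewrite rmorphD mulrDl rmorph1 mul1r.
by move/complexI/eqP; rewrite addr_eq0 => /eqP.
Qed.

Lemma real_roots_opp_self e r : hyp e -> (r \in real_roots h e (fun i => - e i)) -> r = 1.
Proof.
move=> he; rewrite (mem_real_roots hd) // => /eqP hr.
have /(hyp_root_neq0 hd he) : hval (fun i => (r - 1)%:C%C * cvec e i) = 0.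
  rewrite -[RHS]hr; apply: hval_ext => i; rewrite /cvec rmorphB rmorphN mulrBl.
  by rewrite rmorph1 mul1r.
by move/complexI/eqP; rewrite subr_eq0 => /eqP.
Qed.

(** Zero is no root because h(x) is nonzero, and roots of both signs would factor [h] into two
    polynomials vanishing at the origin, neither of which is a unit. *)
Lemma real_roots_same_sign e x : irreducible_elt h -> hyp e -> hyp x ->
  (forall r, r \in real_roots h e x -> 0 < r) \/
  (forall r, r \in real_roots h e x -> r < 0).
Proof.
move=> [_ _ irr] he hx.
have r_neq0 r : r \in real_roots h e x -> r != 0.
  rewrite (mem_real_roots hd) //; apply: contraL => /eqP ->.
  by rewrite -(@hval_ext _ _ h (cvec x)) ?hx.1 // => i; rewrite mul0r add0r.
have not_unit (f : {mpoly R[n]}) : meval (fun=> 0) f = 0 -> f \is a GRing.unit -> False.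
  move=> f0 /mulrV /(congr1 (meval (fun=> 0))).
  by rewrite mevalM f0 mul0r rmorph1 => /eqP; rewrite eq_sym oner_eq0.
have [/allP neg|/allPn[r1 r1P]] := boolP (all (fun r => r < 0) (real_roots h e x)).
  by right.
rewrite -leNgt le_eqVlt eq_sym (negPf (r_neq0 _ r1P)) /= => r10; left=> r rP.
rewrite lt_neqAle eq_sym r_neq0 //= leNgt; apply/negP => r0.
have [f [g [hfg f0 g0]]] := mixed_roots_factor hd he hx r1P r10 rP r0.
by case: (irr f g hfg); apply: not_unit.
Qed.

(** A form of degree 0 is a constant, hence zero or a unit. Positive degree ensures that there is a
    root, so that the sum of the roots has a strict sign. *)
Lemma irreducible_degree_gt0 : irreducible_elt h -> (0 < d)%N.
Proof.
move=> [h0 hunit _]; rewrite lt0n; apply/negP => /eqP d0.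
pose c := meval (fun=> 0) h.
have hC : h = mpolyC n c.
  apply/eqP; rewrite -subr_eq0; apply/eqP; apply: mpoly_eval_eq0 => v.
  rewrite mevalB mevalC /c /meval; have := mmap_scale idfun 0 v hd.
  rewrite d0 expr0 mul1r => <-.
  have -> : (fun i => 0 * v i) = (fun=> 0) by apply/funext => i; rewrite mul0r.
  by rewrite subrr.
have c0 : c != 0 by apply: contra_neq h0 => c0; rewrite hC c0 mpolyC0.
move/negP: hunit; apply; apply/unitrPr; exists (mpolyC n c^-1).
by rewrite {1}hC -mpolyCM mulfV.
Qed.

(** By Vieta this is minus the sum of the roots of h(te + x). Written through a coefficient, it is
    continuous in [x] without any tracking of roots. *)
Definition root_sum e x : R := (linep idfun h e x)`_d.-1 / meval e h.

Lemma root_sumE e x : (0 < d)%N -> hyp e ->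
  root_sum e x = - \sum_(r <- real_roots h e x) r.
Proof.
move=> d0 he; have srr := size_real_roots hd x he.
have <- : (\prod_(r <- real_roots h e x) ('X - r%:P))`_d.-1 =
    - \sum_(r <- real_roots h e x) r.
  by rewrite -{1}srr coefPn_prod_XsubC // srr -lt0n.
apply: (@complexI R); rewrite /root_sum mulrC.
have := congr1 (fun p : {poly C} => p`_d.-1) (nline_real_roots hd x he).
rewrite /= coefZ => E.
have lc : real_complex R (meval e h)^-1 = (hval (cvec e))^-1 by rewrite fmorphV hval_real.
have lE : real_complex R (linep idfun h e x)`_d.-1 =
    (linep (real_complex R) h (cvec e) (cvec x))`_d.-1.
  by rewrite -(@map_linep R n h _ _ idfun (real_complex R) (real_complex R)) // coef_map.
have pE : map_poly (real_complex R) (\prod_(r <- real_roots h e x) ('X - r%:P)) =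
    \prod_(r <- real_roots h e x) ('X - (real_complex R r)%:P).
  rewrite rmorph_prod; apply: eq_bigr => r _.
  by rewrite rmorphB /= map_polyX map_polyC.
by rewrite -lc -lE -rmorphM in E; rewrite E -[RHS]coef_map pE.
Qed.

Lemma root_sum_gt0 e x : (0 < d)%N -> hyp e ->
  (forall r, r \in real_roots h e x -> r < 0) -> 0 < root_sum e x.
Proof.
move=> d0 he rneg; rewrite root_sumE // -sumrN.
have := size_real_roots hd x he; case: (real_roots h e x) rneg => [|r rs] rneg sd.
  by rewrite -sd in d0.
rewrite big_cons ltr_wpDr //; last by rewrite oppr_gt0 rneg ?mem_head.
rewrite big_seq; apply: sumr_ge0 => r' r'rs; rewrite oppr_ge0 ltW // rneg //.
by rewrite inE r'rs orbT.
Qed.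

Lemma root_sum_lt0 e x : (0 < d)%N -> hyp e ->
  (forall r, r \in real_roots h e x -> 0 < r) -> root_sum e x < 0.
Proof.
move=> d0 he rpos; rewrite root_sumE // oppr_lt0.
have := size_real_roots hd x he; case: (real_roots h e x) rpos => [|r rs] rpos sd.
  by rewrite -sd in d0.
rewrite big_cons ltr_wpDr //; last by rewrite rpos ?mem_head.
rewrite big_seq; apply: sumr_ge0 => r' r'rs; rewrite ltW // rpos //.
by rewrite inE r'rs orbT.
Qed.

Definition coef_continuous (F : 'rV[R]_n -> {poly R}) :=
  forall i, continuous (fun u : 'rV[R]_n => (F u)`_i).

Lemma continuous_bigsum (I : Type) (s : seq I) (F : I -> 'rV[R]_n -> R) :
  (forall i, continuous (F i)) -> continuous (fun u => \sum_(i <- s) F i u).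
Proof.
move=> cF; elim: s => [|i s IHs].
  have -> : (fun u => \sum_(i <- [::]) F i u) = (fun=> 0).
    by apply/funext => y; rewrite big_nil.
  by move=> u; exact: cst_continuous.
have -> : (fun u => \sum_(i <- i :: s) F i u) = (fun y => F i y + \sum_(i <- s) F i y).
  by apply/funext => y; rewrite big_cons.
by move=> u; exact: (cvgD (cF i u) (IHs u)).
Qed.

Lemma coef_continuousM F G : coef_continuous F -> coef_continuous G ->
  coef_continuous (fun u => F u * G u).
Proof.
move=> cF cG i.
have -> : (fun u => (F u * G u)`_i) = (fun u => \sum_(j < i.+1) (F u)`_j * (G u)`_(i - j)).
  by apply/funext => u; rewrite coefM.
by apply: continuous_bigsum => j u; exact: (cvgM (cF j u) (cG (i - j)%N u)).
Qed.

Lemma coef_continuous_cst p : coef_continuous (fun=> p).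
Proof. by move=> i u; exact: cst_continuous. Qed.

Lemma coef_continuous_linep (e : 'I_n -> R) :
  coef_continuous (fun u : 'rV[R]_n => linep idfun h e (u ord0)).
Proof.
pose L (u : 'rV[R]_n) j : {poly R} := e j *: 'X + (u ord0 j)%:P.
have cL j : coef_continuous (L^~ j).
  move=> l; have -> : (fun u => (L u j)`_l) =
      (fun u => (e j *: 'X : {poly R})`_l + (if l == 0%N then u ord0 j else 0)).
    by apply/funext => u; rewrite /L coefD coefC.
  have cl : continuous (fun u : 'rV[R]_n => if l == 0%N then u ord0 j else 0).
    by case: (l == 0%N); [exact: coord_continuous | exact: cst_continuous].
  have cst : continuous (fun u : 'rV[R]_n => (e j *: 'X : {poly R})`_l).
    exact: cst_continuous.
  by move=> u; exact: (cvgD (cst u) (cl u)).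
have cX j k : coef_continuous (fun u => L u j ^+ k).
  elim: k => [|k IHk].
    have -> : (fun u => L u j ^+ 0) = (fun=> 1) by apply/funext => u; rewrite expr0.
    exact: coef_continuous_cst.
  have -> : (fun u => L u j ^+ k.+1) = (fun u => L u j * L u j ^+ k).
    by apply/funext => u; rewrite exprS.
  exact: coef_continuousM.
have cP (m : multinom n) : coef_continuous (fun u => mmap1 (L u) m).
  rewrite /mmap1; elim: (index_enum _) => [|j s IHs].
    have -> : (fun u => \prod_(i <- [::]) L u i ^+ m i) = (fun=> 1).
      by apply/funext => u; rewrite big_nil.
    exact: coef_continuous_cst.
  have -> : (fun u => \prod_(i <- j :: s) L u i ^+ m i) =
      (fun u => L u j ^+ m j * \prod_(i <- s) L u i ^+ m i).
    by apply/funext => u; rewrite big_cons.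
  exact: coef_continuousM.
move=> i; have -> : (fun u : 'rV[R]_n => (linep idfun h e (u ord0))`_i) =
    (fun u => \sum_(m <- msupp h) ((mcoeff m h)%:P * mmap1 (L u) m)`_i).
  by apply/funext => u; rewrite /linep /mmap coef_sum.
apply: continuous_bigsum => m; apply: coef_continuousM; last exact: cP.
exact: coef_continuous_cst.
Qed.

Lemma root_sum_continuous e : continuous (fun u : 'rV[R]_n => root_sum e (u ord0)).
Proof.
have cst : continuous (fun u : 'rV[R]_n => (meval e h)^-1) by exact: cst_continuous.
by move=> u; exact: (cvgM (@coef_continuous_linep e d.-1 u) (cst u)).
Qed.

Local Notation Lam := (hyperbolicity_set h).

Lemma mem_hyperbolicity_set (e : 'rV[R]_n) : Lam e <-> hyp (e ord0).
Proof. exact: hyperbolic_wrtP. Qed.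

Lemma component_of_neg_roots (e x : 'rV[R]_n) : Lam e ->
  (forall r, r \in real_roots h (e ord0) (x ord0) -> r < 0) ->
  connected_component Lam e x.
Proof.
move=> /mem_hyperbolicity_set he rneg.
pose g (a : R) : 'rV[R]_n := (1 - a) *: e + a *: x.
have gcont : continuous g.
  move=> a; apply: cvgD; apply: cvgZr_tmp; last exact: cvg_id.
  by apply: cvgB; [exact: cvg_cst | exact: cvg_id].
apply: (@connected_component_max _ Lam (g @` `[0, 1])).
- by exists 0; rewrite /= ?in_itv /= ?lexx ?ler01 // /g subr0 scale1r scale0r addr0.
- move=> y [a /=]; rewrite in_itv /= => /andP[a0 a1] <-; apply/mem_hyperbolicity_set.
  have -> : g a ord0 = (fun i => (1 - a) * e ord0 i + a * x ord0 i).
    by apply/funext => i; rewrite /g !mxE.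
  exact: (hyp_segment hd he a0 a1 (real_roots_lt0 he rneg)).
- apply: connected_continuous_connected; first exact: segment_connected.
  exact: continuous_subspaceT.
- by exists 1; rewrite /= ?in_itv /= ?lexx ?ler01 // /g subrr scale0r add0r scale1r.
Qed.

Lemma hyperbolicity_set_two_components (e : 'rV[R]_n) : irreducible_elt h -> Lam e ->
  [/\ Lam (- e), ~ connected_component Lam e (- e) &
      forall x : 'rV[R]_n, Lam x -> connected_component Lam e x \/ connected_component Lam (- e) x].
Proof.
move=> irr Le; have he := (mem_hyperbolicity_set e).1 Le.
have d0 := irreducible_degree_gt0 irr.
have NeE : (- e) ord0 = (fun i => - e ord0 i) by apply/funext => i; rewrite mxE.
have hNe : hyp ((- e) ord0) by rewrite NeE; apply: hypN.
have LNe : Lam (- e) by apply/mem_hyperbolicity_set.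
split=> //.
  move=> [B [Be BL Bc] BNe].
  have /connected_intervalP gB : connected ((fun u : 'rV[R]_n => root_sum (e ord0) (u ord0)) @` B).
    apply: connected_continuous_connected => //.
    exact/continuous_subspaceT/root_sum_continuous.
  have ge : 0 < root_sum (e ord0) (e ord0).
    by apply: root_sum_gt0 => // r /(real_roots_self he) ->; rewrite oppr_lt0.
  have gNe : root_sum (e ord0) ((- e) ord0) < 0.
    by rewrite NeE; apply: root_sum_lt0 => // r /(real_roots_opp_self he) ->.
  (* A connected set joining [e] to [- e] would contain a hyperbolic direction with root sum 0, but
     its roots all have the same sign. *)
  have [x Bx gx] : ((fun u : 'rV[R]_n => root_sum (e ord0) (u ord0)) @` B) 0.
    by apply: (gB _ _ (ex_intro2 _ _ _ BNe erefl) (ex_intro2 _ _ _ Be erefl)); rewrite !ltW.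
  have hx := (mem_hyperbolicity_set x).1 (BL _ Bx).
  have [rpos|rneg] := real_roots_same_sign irr he hx.
    by have := root_sum_lt0 d0 he rpos; rewrite gx ltxx.
  by have := root_sum_gt0 d0 he rneg; rewrite gx ltxx.
move=> x /mem_hyperbolicity_set hx.
have [rpos|rneg] := real_roots_same_sign irr he hx; last first.
  by left; apply: component_of_neg_roots.
(* Passing from [e] to [- e] negates the roots and turns the positive case into the negative one. *)
right; apply: component_of_neg_roots => // r.
by rewrite NeE real_rootsN // => /rpos; rewrite oppr_gt0.
Qed.

End Components.

Local Open Scope card_scope.

Theorem mainTheorem1 (R : realType) (n : nat) (h : {mpoly R[n]}) :
  (2 < n)%N ->
  homogeneous h ->
  irreducible_elt h ->
  hyperbolic h ->
  connected_components (hyperbolicity_set h) #= `I_2.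
Proof.
move=> _ hd irr [e Le].
have [LNe sep cover] := hyperbolicity_set_two_components (hd : h \is ishomog1 _ mdeg) irr Le.
pose A := connected_component (hyperbolicity_set h) e.
pose B := connected_component (hyperbolicity_set h) (- e).
have AB : A <> B.
  by move=> AB; apply: sep; rewrite -/A AB; apply: connected_component_refl.
have inAB (D : set 'rV[R]_n) : connected_components (hyperbolicity_set h) D -> D = A \/ D = B.
  move=> [x Lx <-]; have [Ax|Bx] := cover x Lx; [left|right];
    by apply/esym; apply: same_connected_component.
have fA : `[< A = A >] = true by apply/asboolP.
have fB : `[< B = A >] = false by apply/asboolPn => BA; apply: AB.
apply/card_set_bijP; exists (fun D => if `[< D = A >] then 0%N else 1%N); split.
- by move=> D _ /=; case: ifP.
- by move=> D E; rewrite !inE => /inAB[->|->] /inAB[->|->] //; rewrite fA fB.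
- move=> [|[|]] //= _; first by exists A; [exists e | rewrite fA].
  by exists B; [exists (- e) | rewrite fB].
Qed.
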